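(* Let $k\ge 1$ be the number of sites and $\varepsilon>0$ with $\varepsilon\le 1/\sqrt{k}$. There exist universal constants $c_1,c_2,c_3>0$ and an adaptive adversary generating the event stream for the HYZ12 protocol (described in the context) such that for every event count $n>c_3\sqrt{k}/\varepsilon$, the server's published estimate $\hat n$ after the $n$-th event satisfies \[ \Pr\!\left[\hat n-n> c_1\sqrt{k}\,\varepsilon\, n\right]\;\ge\;1-e^{-c_2 k}, \] where the probability is over the protocol's internal randomness.
   Context: Distributed counting: a server and $k$ sites; events arrive one at a time, each at some site; $n_i$ is the number of events at site $i$ so far and $n=\sum_i n_i$. The server continuously publishes an estimate $\hat n$ of $n$. An adaptive adversary chooses the site of each next event as a function of all previously published estimates. ${\rm Geom}(q)$ denotes the geometric distribution on $\{1,2,\dots\}$ with $\Pr(G=j)=(1-q)^{j-1}q$. Doubling subprotocol (runs on the same stream): each site, after incrementing $n_i$, sends $(i,n_i)$ to the server whenever $n_i$ is a power of $2$. The server keeps $n'_i$ (last value received from site $i$, initially $0$), $n'=\sum_i n'_i$, and a threshold $\tau=1$; upon receiving $(i,n_i)$ it sets $n'\gets n'+n_i-n'_i$, $n'_i\gets n_i$, and if $n'\ge 2\tau$ it triggers the signal BoundaryReached$(n')$ and sets $\tau\gets n'$. HYZ12 protocol: each site $i$ keeps a transmission probability $p$ (initially $1$, updated by server broadcasts) and its count $n_i$. On each event at site $i$: $n_i\gets n_i+1$, and independently with probability $p$ the site sends Report$(i,n_i)$. The server keeps, for each $i$, $\bar n_i=0$ and $\hat n_i=0$, and $p=1$. Upon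 receiving Report$(i,\bar n)$ it sets $\bar n_i\gets \bar n$, $\hat n_i\gets \bar n_i-1+1/p$ and publishes $\hat n=\sum_j\hat n_j$. Upon BoundaryReached$(n')$ (if an event triggers both, the report is processed first): $p_{\rm old}\gets p$, $p\gets 2^{\min\{0,\lfloor\log_2(\sqrt{k}/(\varepsilon n'))\rfloor\}}$; if $p<1$, then for each site $i$ it independently samples $Z_i=B\cdot G$ with $B\sim{\rm Bernoulli}(1-p/p_{\rm old})$ and $G\sim{\rm Geom}(p)$ independent, sets $\bar n_i\gets\max\{0,\bar n_i-Z_i\}$, sets $\hat n_i\gets 0$ if $\bar n_i=0$ and $\hat n_i\gets\bar n_i-1+1/p$ otherwise, and broadcasts $p$ to all sites. *)

(* Defs.v *)
From HB Require Import structures.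
From mathcomp Require Import all_boot all_order all_algebra.
From mathcomp Require Import all_classical all_reals all_analysis.
Set Implicit Arguments. Unset Strict Implicit. Unset Printing Implicit Defensive.
Import Order.TTheory GRing.Theory Num.Theory.
Local Open Scope ring_scope.
Local Open Scope classical_set_scope.

(* A (discrete) distribution on T is a mass function T -> \bar R; all distributions
   built below have countable support, so esum is the usual (countable) sum. *)
Definition dist (R : realType) (T : Type) := T -> \bar R.

Definition dret (R : realType) (T : choiceType) (x : T) : dist R T :=
  fun y => (\1_[set x] y : R)%:E.

Definition dbind (R : realType) (T U : choiceType) (mu : dist R T) (f : T -> dist R U)
  : dist R U := fun y => \esum_(x in [set: T]) (mu x * f x y)%E.

Definition prob (R : realType) (T : choiceType) (mu : dist R T) (E : set T) : \bar R :=
  \esum_(x in E) mu x.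

Definition bernoulli_d (R : realType) (q : R) : dist R bool :=
  fun b => (if b then q else 1 - q)%:E.

Definition geom_d (R : realType) (q : R) : dist R nat :=
  fun j => (if (0 < j)%N then (1 - q) ^+ j.-1 * q else 0)%:E.

Definition is_pow2 (m : nat) : bool := has (fun j => m == (2 ^ j)%N) (iota 0 m.+1).

Record state (R : realType) (k : nat) := State {
  cnt    : {ffun 'I_k -> nat};
  site_p : R;
  dnp    : {ffun 'I_k -> nat};  (* doubling: n'_i at the server *)
  dn     : nat;                 (* doubling: n' *)
  tau    : nat;
  barn   : {ffun 'I_k -> nat};
  hatn   : {ffun 'I_k -> R};
  srv_p  : R;
  est    : R;
  hist   : seq R
}.

HB.instance Definition _ (R : realType) (k : nat) := gen_eqMixin (state R k).
HB.instance Definition _ (R : realType) (k : nat) := gen_choiceMixin (state R k).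

Definition init_state (R : realType) (k : nat) : state R k :=
  State [ffun => 0%N] 1 [ffun => 0%N] 0 1 [ffun => 0%N] [ffun => 0] 1 0 [::].

Definition new_p (R : realType) (k : nat) (eps : R) (n' : nat) : R :=
  2 ^ (Num.min 0 (Num.floor (ln (Num.sqrt k%:R / (eps * n'%:R)) / ln 2))).

Definition resample_site (R : realType) (k : nat) (p : R) (i : 'I_k)
  (b : bool) (g : nat) (s : state R k) : state R k :=
  let z := if b then g else 0%N in
  let bn := (barn s i - z)%N in
  State (cnt s) (site_p s) (dnp s) (dn s) (tau s)
    [ffun j => if j == i then bn else barn s j]
    [ffun j => if j == i then (if bn == 0%N then 0 else bn%:R - 1 + p^-1) else hatn s j]
    (srv_p s) (est s) (hist s).

Definition resample_all (R : realType) (k : nat) (p pold : R) (s : state R k)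
  : dist R (state R k) :=
  foldr (fun i acc => dbind acc (fun s' =>
           dbind (bernoulli_d (1 - p / pold)) (fun b =>
           dbind (geom_d p) (fun g => dret R (resample_site p i b g s')))))
        (dret R s) (enum 'I_k).

Definition publish (R : realType) (k : nat) (s : state R k) : state R k :=
  State (cnt s) (site_p s) (dnp s) (dn s) (tau s) (barn s) (hatn s) (srv_p s)
    (est s) (rcons (hist s) (est s)).

Definition step (R : realType) (k : nat) (eps : R) (A : seq R -> 'I_k)
  (s : state R k) : dist R (state R k) :=
  let i := A (hist s) in
  let ni := (cnt s i).+1 in
  let cnt1 := [ffun j => if j == i then ni else cnt s j] in
  dbind (bernoulli_d (site_p s)) (fun rep =>
    (* Report(i, n_i), processed first *)
    let barn1 := if rep then [ffun j => if j == i then ni else barn s j] else barn s in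
    let hatn1 := if rep then [ffun j => if j == i then ni%:R - 1 + (srv_p s)^-1
                                                   else hatn s j]
                 else hatn s in
    let est1 := if rep then \sum_(j < k) hatn1 j else est s in
    let msg := is_pow2 ni in
    let dn1 := if msg then (dn s + ni - dnp s i)%N else dn s in
    let dnp1 := if msg then [ffun j => if j == i then ni else dnp s j] else dnp s in
    let bnd := msg && (2 * tau s <= dn1)%N in
    let tau1 := if bnd then dn1 else tau s in
    if bnd then
      let pold := srv_p s in
      let p := new_p k eps dn1 in
      if p < 1 then
        dbind (resample_all p pold
                 (State cnt1 p dnp1 dn1 tau1 barn1 hatn1 p est1 (hist s)))
              (fun s2 => dret R (publish s2))
      else dret R (publish (State cnt1 (site_p s) dnp1 dn1 tau1 barn1 hatn1 p est1 (hist s)))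
    else dret R (publish (State cnt1 (site_p s) dnp1 dn1 tau1 barn1 hatn1 (srv_p s) est1 (hist s)))).

Fixpoint law (R : realType) (k : nat) (eps : R) (A : seq R -> 'I_k) (n : nat)
  : dist R (state R k) :=
  match n with
  | 0%N => dret R (init_state R k)
  | n'.+1 => dbind (law eps A n') (step eps A)
  end.

(* Main.v *)
Require Import Defs.
From HB Require Import structures.
From mathcomp Require Import all_boot all_order all_algebra.
From mathcomp Require Import all_classical all_reals all_analysis.
From mathcomp Require Import ring lra zify.
Import Order.TTheory GRing.Theory Num.Theory.
Local Open Scope ring_scope.
Local Open Scope classical_set_scope.
Set Implicit Arguments.
Unset Strict Implicit.
Unset Printing Implicit Defensive.

(** The adversary keeps sending events to the same site until the published
    estimate changes, then moves on, cyclically through m ~ k/32 sites (through a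
    single site when k is below an absolute constant). A site that is left right
    after a report overestimates its count by 1/p - 1, so a full round produces an
    error of about m/p, and 1/p ~ eps n / sqrt k makes this of order sqrt k eps n.

    Everything is derived from exponential supermartingales. For a fixed n put
    q = 2 eps n / sqrt k, so that 1/q <= p <= 16/q on the time window [n/2, n].
    - The number of visible reports is controlled through 2^-(number of changes).
      A report is invisible only if it reproduces the current estimate, which can
      happen at most once between two resamplings.
    - The error of the sites left since the start t0 of the window is controlled
      through exp(-th (sum_j (hat n_j - n_j - gam) + eta m / p)). Resampling is
      unbiased and costs only a second order term, which eta m / p absorbs: it
      telescopes, so neither the number nor the (random) times of the boundaries
      matter. Sites of unknown error never enter the sum.
    - The published estimate is not updated by a resampling, so it needs a second
      exponential next to the first one; taking the maximum of both loses a factor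
      2 at each resampling, and this factor is paid by the prefactor p q, as a
      resampling that changes something at least halves p. *)

(** * Expectations of discrete distributions *)

Section Expectation.
Variable R : realType.
Local Open Scope ereal_scope.
Implicit Types T U : choiceType.

Lemma esum_ge1 T (a : T -> \bar R) (x : T) :
  (forall y, 0 <= a y) -> a x <= \esum_(y in [set: T]) a y.
Proof.
move=> a0; apply: esum_ge; exists [set x]; last by rewrite fsbig_set1.
by split => //; exact: finite_set1.
Qed.

(** One inequality, [leZ], is clear on finite partial sums. For finite nonzero [c] the converse is
    [leZ] for the inverse of [c]; for infinite [c], either some term is positive and both sides are
    infinite, or all terms vanish. *)
Lemma esumZl T (c : \bar R) (a : T -> \bar R) : 0 <= c -> (forall x, 0 <= a x) ->
  \esum_(x in [set: T]) (c * a x) = c * \esum_(x in [set: T]) a x.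
Proof.
move=> c0 a0.
have leZ (d : \bar R) (b : T -> \bar R) : 0 <= d -> (forall x, 0 <= b x) ->
    \esum_(x in [set: T]) (d * b x) <= d * \esum_(x in [set: T]) b x.
  move=> d0 b0; apply: ge_ereal_sup => _ [X [finX _] <-].
  rewrite -ge0_mule_fsumr//; apply: lee_wpmul2l => //.
  by apply: esum_ge; exists X.
apply/eqP; rewrite eq_le leZ//=.
case: c c0 => [r| |//] c0.
- have r0 : (0 <= r)%R by rewrite -lee_fin.
  have [->|rn0] := eqVneq r 0%R.
    by rewrite mul0e; apply: esum_ge0 => x _; rewrite mul0e.
  have r0' : (0 < r)%R by rewrite lt_neqAle eq_sym rn0.
  rewrite -lee_pdivlMl//.
  apply: le_trans (leZ (r^-1)%:E _ _ _); last 2 first.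
  + by rewrite lee_fin invr_ge0 ltW.
  + by move=> x; rewrite mule_ge0// ltW.
  + apply: le_esum => x _; rewrite muleA -EFinM mulVf ?gt_eqF// mul1e//.
- have [[x ax]|H] := pselect (exists x, 0 < a x).
    apply: le_trans (esum_ge1 x _) => [|y]; last by rewrite mule_ge0.
    by rewrite [leRHS]gt0_mulye// leey.
  rewrite esum1 ?mule0; first by apply: esum_ge0 => x _; rewrite mule_ge0.
  move=> x _; apply/eqP; rewrite eq_le a0 andbT leNgt; apply/negP => ax.
  by apply: H; exists x.
Qed.

Lemma esum_swap T U (a : T -> U -> \bar R) : (forall x y, 0 <= a x y) ->
  \esum_(x in [set: T]) \esum_(y in [set: U]) a x y =
  \esum_(y in [set: U]) \esum_(x in [set: T]) a x y.
Proof.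
move=> a0; rewrite !esum_esum//.
rewrite (@reindex_esum _ _ _ ([set: U] `*`` (fun=> [set: T])) _ (fun z => (z.2, z.1)))//.
split => //; first by move=> [x y] [x' y'] _ _ /= [-> ->].
by move=> [x y] _; exists (y, x).
Qed.

Definition Ex T (mu : dist R T) (f : T -> \bar R) : \bar R :=
  \esum_(x in [set: T]) (mu x * f x).

Definition supp T (mu : dist R T) (P : T -> Prop) : Prop :=
  forall x, mu x != 0 -> P x.

Definition nonneg T (mu : dist R T) : Prop := forall x, 0 <= mu x.

Lemma dret_ge0 T (x : T) : nonneg (dret R x).
Proof. by move=> y; rewrite /dret lee_fin indicE; case: (_ \in _). Qed.

Lemma dbind_ge0 T U (mu : dist R T) (g : T -> dist R U) :
  nonneg mu -> (forall x, nonneg (g x)) -> nonneg (dbind mu g).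
Proof. by move=> h1 h2 y; apply: esum_ge0 => x _; apply: mule_ge0; [exact: h1|exact: h2]. Qed.

Lemma bernoulli_ge0 (p : R) : (0 <= p <= 1)%R -> nonneg (bernoulli_d p).
Proof.
move=> /andP[p0 p1] b; rewrite /bernoulli_d lee_fin.
by case: b; rewrite ?subr_ge0.
Qed.

Lemma geom_ge0 (p : R) : (0 <= p <= 1)%R -> nonneg (geom_d p).
Proof.
move=> /andP[p0 p1] j; rewrite /geom_d lee_fin; case: ifP => // _.
by rewrite mulr_ge0// exprn_ge0// subr_ge0.
Qed.

Lemma supp_ret T (x : T) (P : T -> Prop) : P x -> supp (dret R x) P.
Proof.
move=> Px y; rewrite /dret indicE; case: (boolP (y \in [set x])); last by rewrite eqxx.
by rewrite inE => /= ->.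
Qed.

Lemma supp_bind T U (mu : dist R T) (g : T -> dist R U) (P : T -> Prop) (Q : U -> Prop) :
  supp mu P -> (forall x, P x -> supp (g x) Q) -> supp (dbind mu g) Q.
Proof.
move=> muP gQ y; rewrite /dbind => ney; apply: contrapT => nQ.
move: ney; rewrite esum1 ?eqxx// => x _.
have [->|nx] := eqVneq (mu x) 0; first by rewrite mul0e.
have [->|ny] := eqVneq (g x y) 0; first by rewrite mule0.
by exfalso; apply: nQ; apply: gQ ny; apply: muP.
Qed.

Lemma suppT T (mu : dist R T) (P : T -> Prop) : (forall x, P x) -> supp mu P.
Proof. by move=> h x _. Qed.

Lemma Ex_ge0 T (mu : dist R T) f : nonneg mu -> (forall x, 0 <= f x) -> 0 <= Ex mu f.
Proof. by move=> h1 h2; apply: esum_ge0 => x _; rewrite mule_ge0. Qed.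

Lemma Ex_ret T (x : T) f : (forall x, 0 <= f x) -> Ex (dret R x) f = f x.
Proof.
move=> f0; rewrite /Ex (esumID [set x])//; last first.
  by move=> y _; rewrite mule_ge0// dret_ge0.
rewrite !setTI esum_set1 ?mule_ge0 ?dret_ge0// esum1 ?adde0.
  by rewrite /dret indicE mem_set// mul1e.
by move=> y /= yx; rewrite /dret indicE memNset// mul0e.
Qed.

Lemma Ex_bind T U (mu : dist R T) (g : T -> dist R U) f :
  nonneg mu -> (forall x, nonneg (g x)) -> (forall y, 0 <= f y) ->
  Ex (dbind mu g) f = Ex mu (fun x => Ex (g x) f).
Proof.
move=> mu0 g0 f0; rewrite /Ex /dbind.
under eq_esum => y _.
  rewrite muleC -esumZl//; last by move=> x; rewrite mule_ge0// g0.
  over.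
rewrite esum_swap; last by move=> y x; rewrite !mule_ge0// g0.
apply: eq_esum => x _; rewrite -esumZl//; last by move=> y; rewrite mule_ge0// g0.
by apply: eq_esum => y _; rewrite muleCA (muleC (f y)).
Qed.

Lemma le_Ex T (mu : dist R T) (P : T -> Prop) f g :
  nonneg mu -> supp mu P -> (forall x, P x -> f x <= g x) -> Ex mu f <= Ex mu g.
Proof.
move=> mu0 sP fg; apply: le_esum => x _.
have [->|nx] := eqVneq (mu x) 0; first by rewrite !mul0e.
by apply: lee_wpmul2l => //; apply: fg; apply: sP.
Qed.

Lemma eq_Ex T (mu : dist R T) (P : T -> Prop) f g :
  nonneg mu -> supp mu P -> (forall x, P x -> f x = g x) -> Ex mu f = Ex mu g.
Proof.
by move=> mu0 sP fg; apply/eqP; rewrite eq_le !(le_Ex mu0 sP)// => x /fg ->.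
Qed.

Lemma ExD T (mu : dist R T) f g : nonneg mu ->
  (forall x, 0 <= f x) -> (forall x, 0 <= g x) ->
  Ex mu (fun x => f x + g x) = Ex mu f + Ex mu g.
Proof.
move=> mu0 f0 g0; rewrite /Ex -esumD; try by move=> x _; rewrite mule_ge0.
by apply: eq_esum => x _; rewrite ge0_muleDr.
Qed.

Lemma ExZ T (mu : dist R T) f (c : \bar R) : nonneg mu ->
  0 <= c -> (forall x, 0 <= f x) ->
  Ex mu (fun x => c * f x) = c * Ex mu f.
Proof.
move=> mu0 c0 f0; rewrite /Ex -esumZl//; last by move=> x; rewrite mule_ge0.
by apply: eq_esum => x _; rewrite muleCA.
Qed.

Definition mass1 T (mu : dist R T) := Ex mu (fun=> 1) = 1.

Lemma Ex_cst T (mu : dist R T) (c : \bar R) : nonneg mu -> mass1 mu ->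
  0 <= c -> Ex mu (fun=> c) = c.
Proof.
move=> mu0 m1 c0; transitivity (Ex mu (fun x => c * 1)).
  by congr Ex; apply/funext => x; rewrite mule1.
by rewrite ExZ// m1 mule1.
Qed.

Lemma Ex_le_cst T (mu : dist R T) (P : T -> Prop) f (c : \bar R) :
  nonneg mu -> mass1 mu -> supp mu P -> 0 <= c ->
  (forall x, P x -> f x <= c) -> Ex mu f <= c.
Proof. by move=> mu0 m1 sP c0 fc; rewrite -(Ex_cst mu0 m1 c0); apply: (le_Ex mu0 sP). Qed.

Lemma mass1_ret T (x : T) : mass1 (dret R x).
Proof. by rewrite /mass1 Ex_ret. Qed.

Lemma mass1_bind T U (mu : dist R T) (g : T -> dist R U) (P : T -> Prop) :
  nonneg mu -> (forall x, nonneg (g x)) -> supp mu P ->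
  mass1 mu -> (forall x, P x -> mass1 (g x)) -> mass1 (dbind mu g).
Proof.
move=> mu0 g0 sP m1 g1; rewrite /mass1 Ex_bind// (eq_Ex (g := fun=> 1) mu0 sP)//.
Qed.

Lemma Ex_bernoulli (p : R) f : (0 <= p <= 1)%R -> (forall b, 0 <= f b) ->
  Ex (bernoulli_d p) f = p%:E * f true + (1 - p)%:E * f false.
Proof.
move=> hp f0; have h0 := bernoulli_ge0 hp.
rewrite /Ex (esumID [set true])//; last by move=> b _; rewrite mule_ge0.
rewrite !setTI (_ : ~` [set true] = [set false]); last first.
  by apply/seteqP; split => -[] //= h; exfalso; apply: h.
by rewrite !esum_set1 ?mule_ge0.
Qed.

Lemma mass1_bernoulli (p : R) : (0 <= p <= 1)%R -> mass1 (bernoulli_d p).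
Proof.
by move=> hp; rewrite /mass1 Ex_bernoulli// !mule1 -EFinD addrC subrK.
Qed.

Lemma Ex_geom_series (p : R) f : (0 <= p <= 1)%R -> (forall j, 0 <= f j) ->
  Ex (geom_d p) f = \sum_(0 <= j <oo) (((1 - p) ^+ j * p)%:E * f j.+1).
Proof.
move=> hp f0; have h0 := geom_ge0 hp.
rewrite /Ex -nneseries_esumT//; last by move=> j; rewrite mule_ge0.
rewrite nneseries_recl//; last by move=> j; rewrite mule_ge0.
rewrite {1}/geom_d mul0e add0e.
rewrite -(@nneseries_addn _ (fun j => geom_d p j * f j) 1) //.
  by apply: eq_eseriesr => j _; rewrite addn1.
by move=> j; rewrite mule_ge0.
Qed.

(** Memorylessness: given that the first trial fails, the variable is one plus a fresh copy. *)
Lemma Ex_geom_shift (p : R) f : (0 <= p <= 1)%R -> (forall j, 0 <= f j) ->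
  Ex (geom_d p) f = p%:E * f 1%N + (1 - p)%:E * Ex (geom_d p) (fun j => f j.+1).
Proof.
move=> hp f0; have h0 := geom_ge0 hp.
have q0 : (0 <= 1 - p)%R by rewrite subr_ge0; case/andP: hp.
have hc j : 0 <= ((1 - p) ^+ j * p)%:E.
  by rewrite lee_fin mulr_ge0 ?exprn_ge0//; case/andP: hp.
rewrite !Ex_geom_series// nneseries_recl//; last first.
  by move=> j; rewrite mule_ge0.
rewrite expr0 mul1r; congr (_ + _).
rewrite -(@nneseries_addn _ (fun j => ((1 - p) ^+ j * p)%:E * f j.+1) 1)//; last first.
  by move=> j; rewrite mule_ge0.
rewrite -nneseriesZl//; last by move=> j _; rewrite mule_ge0.
by apply: eq_eseriesr => j _; rewrite addn1 exprS -mulrA EFinM muleA.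
Qed.

Lemma mass1_geom (p : R) : (0 < p <= 1)%R -> mass1 (geom_d p).
Proof.
move=> /andP[p0 p1]; have hp : (0 <= p <= 1)%R by rewrite ltW.
rewrite /mass1 Ex_geom_series//.
apply/cvg_lim => //.
have -> : (fun n => \sum_(0 <= i < n) (((1 - p) ^+ i * p)%:E * 1)) =
          EFin \o (fun n => 1 - (1 - p) ^+ n)%R.
  apply/funext => n /=; elim: n => [|n IH]; first by rewrite big_geq// expr0 subrr.
  rewrite big_nat_recr//= IH mule1 -EFinD; congr (_%:E).
  by rewrite exprS; ring.
apply: cvg_EFin; first by near=> n.
rewrite -[X in _ --> X]subr0; apply: cvgB; first exact: cvg_cst.
by apply: cvg_expr; rewrite ger0_norm ?subr_ge0//; lra.
Unshelve. all: by end_near. Qed.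

Lemma prob_Ex T (mu : dist R T) (E : set T) :
  prob mu E = Ex mu (fun x => (\1_E x)%:E).
Proof.
rewrite /prob esum_mkcond; apply: eq_esum => x _; rewrite indicE.
by case: (x \in E); rewrite ?mule1 ?mule0.
Qed.

(** Markov's inequality for the complement of [E]: on the support, [f] dominates the indicator of
    failure. *)
Lemma prob_ge T (mu : dist R T) (P : T -> Prop) (E : set T) (f : T -> \bar R) (b : R) :
  nonneg mu -> mass1 mu -> supp mu P -> (forall x, 0 <= f x) ->
  (forall x, P x -> ~ E x -> 1 <= f x) -> Ex mu f <= b%:E ->
  (1 - b)%:E <= prob mu E.
Proof.
move=> mu0 m1 sP f0 fE fb.
have e0 x : 0 <= (\1_E x : R)%:E by rewrite lee_fin indicE; case: (_ \in _).
have : 1 <= prob mu E + Ex mu f.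
  rewrite prob_Ex -ExD// -[leLHS]m1; apply: (le_Ex mu0 sP) => x Px.
  rewrite indicE; have [xE|xE] := boolP (x \in E); first by rewrite leeDl.
  by rewrite add0e; apply: fE => // Ex0; move: xE; rewrite mem_set.
move=> h; rewrite EFinB leeBlDr//; apply: le_trans h _; exact: leeD.
Qed.

Section BindOnSupport.
Variables (T U : choiceType) (mu : dist R T) (g : T -> dist R U) (P : T -> Prop).
Hypotheses (mu0 : nonneg mu) (muP : supp mu P) (g0 : forall x, P x -> nonneg (g x)).

(** [step] may take negative values at unreachable states, where [site_p] is arbitrary. Replacing
    the kernel by 0 where [mu] vanishes keeps the bind and makes the kernel nonnegative
    everywhere. *)
Let g' x : dist R U := if mu x == 0 then fun=> 0 else g x.

Let g'0 x : nonneg (g' x).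
Proof. by rewrite /g'; case: eqVneq => [_ y|/muP/g0]. Qed.

Let bindE : dbind mu g = dbind mu g'.
Proof.
apply/funext => y; apply: eq_esum => x _; rewrite /g'.
by case: eqVneq => [->|//]; rewrite !mul0e.
Qed.

Lemma dbind_ge0_supp : nonneg (dbind mu g).
Proof. by rewrite bindE; exact: dbind_ge0. Qed.

Lemma Ex_bind_supp f : (forall y, 0 <= f y) ->
  Ex (dbind mu g) f = Ex mu (fun x => Ex (g x) f).
Proof.
move=> f0; rewrite bindE Ex_bind//; apply: eq_esum => x _; rewrite /g'.
by case: eqVneq => [->|//]; rewrite !mul0e.
Qed.

Lemma mass1_bind_supp : mass1 mu -> (forall x, P x -> mass1 (g x)) ->
  mass1 (dbind mu g).
Proof.
move=> m1 g1; rewrite /mass1 Ex_bind_supp// (eq_Ex (g := fun=> 1) mu0 muP)//.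
Qed.

End BindOnSupport.

End Expectation.

(** * The transmission probability *)

Section TransmissionProbability.
Variable R : realType.
Implicit Types x eps : R.

Lemma ln2_gt0 : 0 < ln 2 :> R.
Proof. by rewrite ln_gt0//; lra. Qed.

Lemma exp2_floor_log x : 0 < x ->
  x / 2 <= 2 ^ Num.floor (ln x / ln 2) <= x.
Proof.
move=> x0; set y := ln x / ln 2.
have xE : 2 `^ y = x.
  by rewrite /powR pnatr_eq0/= /y divfK ?gt_eqF ?ln2_gt0// lnK.
have two0 : 0 <= 2 :> R by lra.
apply/andP; split; last first.
  by rewrite -powR_intmul// -[leRHS]xE ler_powR ?floor_le//; lra.
rewrite ler_pdivrMr; last by lra.
rewrite -[X in X <= _]xE -(powR_intmul _ two0).
have -> : 2 `^ (Num.floor y)%:~R * 2 = 2 `^ ((Num.floor y)%:~R + 1) :> R.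
  by rewrite powRD ?powRr1// pnatr_eq0/= implybT.
rewrite ler_powR//; first lra.
by have := floorD1_gt y; rewrite intrD => /ltW.
Qed.

Variables (k : nat) (eps : R).

Lemma new_p_gt0 n : 0 < new_p k eps n.
Proof. by rewrite /new_p exprz_gt0//; lra. Qed.

Lemma new_p_le1 n : new_p k eps n <= 1.
Proof. by rewrite /new_p -[leRHS](expr0z 2) ler_weXz2l ?ge_min ?lexx//; lra. Qed.

Hypotheses (k0 : (0 < k)%N) (eps0 : 0 < eps).

Lemma new_pE n : (0 < n)%N -> new_p k eps n =
  Num.min 1 (2 ^ (Num.floor (ln (Num.sqrt k%:R / (eps * n%:R)) / ln 2))).
Proof.
move=> n0; rewrite /new_p; set z := Num.floor _.
have [z0|z0] := leP 0 z.
  by rewrite expr0z min_l// -[leLHS](expr0z 2) ler_weXz2l//; lra.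
by rewrite min_r// -[leRHS](expr0z 2) ler_weXz2l ?ltW//; lra.
Qed.

Lemma log_arg_gt0 n : (0 < n)%N -> 0 < Num.sqrt k%:R / (eps * n%:R).
Proof. by move=> n0; rewrite divr_gt0 ?sqrtr_gt0 ?mulr_gt0 ?ltr0n. Qed.

Lemma new_p_ub n : (0 < n)%N -> new_p k eps n <= Num.sqrt k%:R / (eps * n%:R).
Proof.
move=> n0; rewrite new_pE// ge_min; apply/orP; right.
by have /andP[] := exp2_floor_log (log_arg_gt0 n0).
Qed.

Lemma new_p_lb n x : (0 < n)%N -> x <= 1 -> x <= Num.sqrt k%:R / (eps * n%:R) / 2 ->
  x <= new_p k eps n.
Proof.
move=> n0 x1 xn; rewrite new_pE// le_min x1/=.
by have /andP[+ _] := exp2_floor_log (log_arg_gt0 n0); exact: le_trans.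
Qed.

Lemma new_p_le a b : (0 < a)%N -> (a <= b)%N -> new_p k eps b <= new_p k eps a.
Proof.
move=> a0 ab; rewrite /new_p ler_weXz2l//; first lra.
rewrite le_min ge_min lexx/= ge_min; apply/orP; right; apply: le_floor.
have b0 : (0 < b)%N by exact: leq_trans ab.
rewrite ler_pM2r ?invr_gt0 ?ln2_gt0// ler_ln ?posrE ?log_arg_gt0//.
rewrite ler_pM2l ?sqrtr_gt0 ?ltr0n// lef_pV2 ?posrE ?mulr_gt0 ?ltr0n//.
by rewrite ler_pM2l// ler_nat.
Qed.

(** Both values are powers of two with integer exponents, so a strict decrease is at least a
    halving. *)
Lemma new_p_halves a b : (0 < a)%N -> (a <= b)%N ->
  new_p k eps b = new_p k eps a \/ new_p k eps b <= new_p k eps a / 2.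
Proof.
move=> a0 ab; have := new_p_le a0 ab; rewrite /new_p.
move: (Num.min _ _) (Num.min _ _) => v u; rewrite ler_eXz2l; last lra.
rewrite le_eqVlt => /orP[/eqP ->|uv]; [by left|right].
have -> : 2 ^ v / 2 = 2 ^ (v - 1) :> R by rewrite expfzDr ?exprN1 ?pnatr_eq0.
by rewrite ler_weXz2l//; [lra | lia].
Qed.

(** Makes the initial p agree with the formula at [tau = 1]: since eps <= 1/sqrt k <= 1 <= sqrt k,
    the argument of the logarithm is at least 1. *)
Lemma new_p1 : eps <= (Num.sqrt k%:R)^-1 -> new_p k eps 1 = 1.
Proof.
move=> epsk; apply/eqP; rewrite eq_le new_p_le1/= /new_p -[leLHS](expr0z 2).
rewrite ler_weXz2l//; first lra.
rewrite le_min lexx/= floor_ge_int//.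
apply: divr_ge0; last by rewrite ltW// ln2_gt0.
apply: ln_ge0; rewrite mulr1.
have s0 : 0 < Num.sqrt k%:R :> R by rewrite sqrtr_gt0 ltr0n.
rewrite ler_pdivlMr// mul1r; apply: le_trans epsk _.
have s1 : 1 <= Num.sqrt k%:R :> R.
  by rewrite -[leLHS]sqrtr1 ler_sqrt ?ltr0n// ler1n.
by apply: (le_trans _ s1); rewrite invf_le1.
Qed.

End TransmissionProbability.

(** * The protocol step and its invariants *)

Lemma is_pow2P n : reflect (exists a, n = (2 ^ a)%N) (is_pow2 n).
Proof.
apply: (iffP hasP) => [[a _ /eqP ->]|[a ->]]; first by exists a.
by exists a; rewrite // mem_iota /= add0n ltnS; exact: ltnW (ltn_expl a _).
Qed.

(** * Resampling the sites at a boundary *)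

Section Resampling.
Variables (R : realType) (k : nat).
Implicit Types (s : state R k) (p : R).

Definition hat_of p (b : nat) : R := if b == 0%N then 0 else b%:R - 1 + p^-1.

(** The sure effects of a pass over the sites of [l]. The field [rs_est] matters: a resampling
    changes the estimates of the sites but not the published sum. *)
Record resampling (pnew pold : R) (l : seq 'I_k) (s0 s : state R k) : Prop := Resampling {
  rs_cnt : cnt s = cnt s0;
  rs_site : site_p s = site_p s0;
  rs_dnp : dnp s = dnp s0;
  rs_dn : dn s = dn s0;
  rs_tau : tau s = tau s0;
  rs_srv : srv_p s = srv_p s0;
  rs_est : est s = est s0;
  rs_hist : hist s = hist s0;
  rs_bar : forall j, (barn s j <= barn s0 j)%N;
  rs_barN : forall j, j \notin l -> barn s j = barn s0 j;
  rs_hat : forall j, hatn s j =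
    if j \in l then hat_of pnew (barn s j) else hatn s0 j }.

Definition resample_one p pold (i : 'I_k) s : dist R (state R k) :=
  dbind (bernoulli_d (1 - p / pold)) (fun b =>
    dbind (geom_d p) (fun g => dret R (resample_site p i b g s))).

Lemma ratio_in01 p pold : 0 < p -> p <= pold -> 0 <= p / pold <= 1.
Proof.
move=> p0 pp; have pold0 : 0 < pold by exact: lt_le_trans pp.
by apply/andP; split; [apply: divr_ge0; exact: ltW | rewrite ler_pdivrMr// mul1r].
Qed.

Lemma resample_one_ge0 p pold i s : 0 < p -> p <= pold -> p <= 1 ->
  nonneg (resample_one p pold i s).
Proof.
move=> p0 pp p1; apply: dbind_ge0 => [|b].
  by apply: bernoulli_ge0; have := ratio_in01 p0 pp; lra.
by apply: dbind_ge0 => [|g]; [apply: geom_ge0; lra | exact: dret_ge0].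
Qed.

Lemma mass1_resample_one p pold i s : 0 < p -> p <= pold -> p <= 1 ->
  mass1 (resample_one p pold i s).
Proof.
move=> p0 pp p1; have hb : 0 <= 1 - p / pold <= 1 by have := ratio_in01 p0 pp; lra.
have hg : 0 <= p <= 1 by lra.
apply: (@mass1_bind _ _ _ _ _ (fun=> True)) => //.
- exact: bernoulli_ge0.
- by move=> b; apply: dbind_ge0 => [|g]; [exact: geom_ge0 | exact: dret_ge0].
- exact: mass1_bernoulli.
move=> b _; apply: (@mass1_bind _ _ _ _ _ (fun=> True)) => //.
- exact: geom_ge0.
- by move=> g; exact: dret_ge0.
- by apply: mass1_geom; lra.
by move=> g _; exact: mass1_ret.
Qed.

Definition resample_list p pold s (l : seq 'I_k) : dist R (state R k) :=
  foldr (fun i acc => dbind acc (resample_one p pold i)) (dret R s) l.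

Lemma resample_allE p pold s : resample_all p pold s = resample_list p pold s (enum 'I_k).
Proof. by []. Qed.

Section ResampleAll.
Variables (p pold : R) (s0 : state R k).
Hypotheses (p0 : 0 < p) (pp : p <= pold) (p1 : p <= 1).

Lemma resample_list_ge0 l : nonneg (resample_list p pold s0 l).
Proof.
elim: l => [|i l IH] /=; first exact: dret_ge0.
by apply: dbind_ge0 => // s; exact: resample_one_ge0.
Qed.

Lemma supp_resample_list l : supp (resample_list p pold s0 l) (resampling p pold l s0).
Proof.
elim: l => [|i l IH] /=; first by apply: supp_ret.
apply: supp_bind IH _ => s [? ? ? ? ? ? ? ? bar barN hat].
apply: (@supp_bind _ _ _ _ _ (fun=> True)); first exact: suppT.
move=> b _; apply: (@supp_bind _ _ _ _ _ (fun=> True)); first exact: suppT.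
move=> g _; apply: supp_ret; split => //.
- by move=> j /=; rewrite ffunE; have := bar j; case: eqP => [->|//]; lia.
- by move=> j; rewrite inE negb_or => /andP[/negbTE ji jl] /=; rewrite ffunE ji barN.
- by move=> j; rewrite inE /= !ffunE; case: eqP => [->|_] /=; rewrite ?hat.
Qed.

Lemma mass1_resample_list l : mass1 (resample_list p pold s0 l).
Proof.
elim: l => [|i l IH] /=; first exact: mass1_ret.
apply: (@mass1_bind _ _ _ _ _ (fun=> True)) => // [|s|s _].
- exact: resample_list_ge0.
- exact: resample_one_ge0.
- exact: mass1_resample_one.
Qed.

End ResampleAll.

(** The coin has parameter 1 - p/p = 0, so no count is lowered and each estimate is rewritten with
    its own value. A boundary that keeps p is thus harmless. *)
Lemma Ex_resample_trivial p (s : state R k) f : 0 < p -> p <= 1 ->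
  (forall j, hatn s j = hat_of p (barn s j)) -> (forall s, 0 <= f s)%E ->
  Ex (resample_all p p s) f = f s.
Proof.
move=> p0 p1 hatE; rewrite resample_allE.
elim: (enum _) f => [|i l IH] f f0 /=; first by rewrite Ex_ret.
rewrite Ex_bind//; last 2 first.
- exact: resample_list_ge0.
- by move=> s'; exact: resample_one_ge0.
rewrite IH; last by move=> s'; apply: Ex_ge0 => //; exact: resample_one_ge0.
have hg : 0 <= p <= 1 by lra.
rewrite /resample_one divff ?gt_eqF// subrr Ex_bind//; last 2 first.
- by apply: bernoulli_ge0; rewrite lexx ler01.
- by move=> b; apply: dbind_ge0 => [|g]; [exact: geom_ge0 | exact: dret_ge0].
rewrite Ex_bernoulli ?lexx ?ler01//; last first.
  move=> b; apply: Ex_ge0 => //; apply: dbind_ge0 => [|g]; [exact: geom_ge0 | exact: dret_ge0].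
rewrite mul0e add0e subr0 mul1e Ex_bind//; last 2 first.
- exact: geom_ge0.
- by move=> g; exact: dret_ge0.
transitivity (Ex (geom_d p) (fun=> f s)); last first.
  by rewrite Ex_cst//; [exact: geom_ge0 | apply: mass1_geom; lra].
congr Ex; apply/funext => g; rewrite Ex_ret//; congr f.
case: s hatE {IH} => cn sp dp d ta ba ha sv es hi /= hatE.
rewrite /resample_site /=; congr State; apply/ffunP => j; rewrite ffunE.
  by case: eqP => [->|//]; rewrite subn0.
by case: eqP => [->|//]; rewrite subn0 hatE.
Qed.

End Resampling.

(** * One event of the protocol and the state invariant *)

Section Protocol.
Variables (R : realType) (k : nat) (eps : R) (A : seq R -> 'I_k).
Implicit Types (s : state R k) (p : R) (rep : bool).

Definition cur s := A (hist s).
Definition next_count s := (cnt s (cur s)).+1.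
(** The doubling subprotocol does not see the report coin, so the boundary and the next p are
    functions of the state before the event. *)
Definition next_dn s :=
  if is_pow2 (next_count s) then (dn s + next_count s - dnp s (cur s))%N else dn s.
Definition boundary s := is_pow2 (next_count s) && (2 * tau s <= next_dn s)%N.
Definition next_tau s := if boundary s then next_dn s else tau s.
Definition next_p s := new_p k eps (next_tau s).

(** The state between report and resampling: [srv_p] and [site_p] are already new, while [hatn]
    still refers to the old probability. *)
Definition reported rep s : state R k :=
  let i := cur s in let ni := next_count s in
  let hatn1 := if rep then [ffun j => if j == i then ni%:R - 1 + (srv_p s)^-1
                                      else hatn s j]
               else hatn s in
  State [ffun j => if j == i then ni else cnt s j] (next_p s)
    (if is_pow2 ni then [ffun j => if j == i then ni else dnp s j] else dnp s)
    (next_dn s) (next_tau s)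
    (if rep then [ffun j => if j == i then ni else barn s j] else barn s)
    hatn1 (next_p s)
    (if rep then \sum_(j < k) hatn1 j else est s) (hist s).

Definition resampled rep s : dist R (state R k) :=
  if boundary s && (next_p s < 1)
  then resample_all (next_p s) (srv_p s) (reported rep s)
  else dret R (reported rep s).

(* [p] is the probability that the estimates [hatn] refer to; it lags behind
   [srv_p s] between a boundary and the end of the resampling. *)
Record core (t : nat) p s : Prop := Core {
  core_site : site_p s = srv_p s;
  core_p : srv_p s = new_p k eps (tau s);
  core_tau0 : (0 < tau s)%N;
  core_tau : (tau s <= maxn 1 t)%N;
  core_dn : dn s = (\sum_j dnp s j)%N;
  core_dn_lt : (dn s < 2 * tau s)%N;
  core_cnt : (\sum_j cnt s j)%N = t;
  core_dnp : forall j, (cnt s j = 0 /\ dnp s j = 0)%N \/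
     exists a, dnp s j = (2 ^ a)%N /\ (2 ^ a <= cnt s j < 2 ^ a.+1)%N;
  core_bar : forall j, (barn s j <= cnt s j)%N;
  core_hat : forall j, hatn s j = hat_of p (barn s j);
  core_unvisited : forall j, (forall h, A h != j) -> cnt s j = 0%N }.

Record valid (t : nat) s : Prop := Valid {
  valid_core : core t (srv_p s) s;
  valid_size : size (hist s) = t;
  valid_est : last 0 (hist s) = est s }.

Lemma core_dnp_le t p s j : core t p s -> (dnp s j <= cnt s j <= 2 * dnp s j)%N.
Proof.
move=> c; case: (core_dnp c j) => [[-> ->]//|[a [-> /andP[-> h]]]] /=.
by rewrite -expnS ltnW.
Qed.

(** The last message of a site is at least half its count, so t <= 2 n'; and n' < 2 tau, since a
    larger n' would have raised the signal. *)
Lemma core_tau_lb t p s : core t p s -> (t <= 4 * tau s)%N.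
Proof.
move=> c; have := core_dn_lt c; suff : (t <= 2 * dn s)%N by lia.
rewrite (core_dn c) -(core_cnt c) big_distrr/=; apply: leq_sum => j _.
by have /andP[] := core_dnp_le j c.
Qed.

Lemma core_srv_p t p s : core t p s -> 0 < srv_p s <= 1.
Proof. by move=> c; rewrite (core_p c) new_p_gt0 new_p_le1. Qed.

Lemma sum_update (f : 'I_k -> nat) (i : 'I_k) (x : nat) :
  (\sum_j [ffun j => if j == i then x else f j] j = \sum_j f j + x - f i)%N.
Proof.
rewrite (bigD1 i)//= [in RHS](bigD1 i)//= ffunE eqxx.
under eq_bigr => j /negbTE ji do rewrite ffunE ji.
lia.
Qed.

Lemma next_tau_ge s : (0 < tau s)%N -> (tau s <= next_tau s)%N.
Proof. by rewrite /next_tau /boundary; case: ifP => // /andP[_]; lia. Qed.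

Lemma core_reported t rep s : core t (srv_p s) s ->
  core t.+1 (srv_p s) (reported rep s).
Proof.
move=> c.
have dnpi : (dnp s (cur s) <= dn s)%N.
  by rewrite (core_dn c) (bigD1 (cur s))//= leq_addr.
have sumE : (\sum_j cnt (reported rep s) j)%N = t.+1.
  rewrite /= sum_update (core_cnt c) /next_count; lia.
have dnpE : forall j, (cnt (reported rep s) j = 0 /\ dnp (reported rep s) j = 0)%N \/
     exists a, dnp (reported rep s) j = (2 ^ a)%N /\
       (2 ^ a <= cnt (reported rep s) j < 2 ^ a.+1)%N.
  move=> j; rewrite /= ffunE; have [->{j}|ji] := eqVneq j (cur s).
    right; have [/is_pow2P [a aE]|/is_pow2P np2] := boolP (is_pow2 (next_count s)).
      by exists a; rewrite ffunE eqxx aE leqnn ltn_exp2l ?ltnSn.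
    (* Here the new count is not a power of two. This excludes the first event of a site, whose
       count is 2^0, and excludes reaching 2^(a+1). *)
    case: (core_dnp c (cur s)) => [[c0 d0]|[a [-> /andP[h1 h2]]]].
      by case: np2; exists 0%N; rewrite /next_count c0.
    exists a; split => //; rewrite /next_count; apply/andP; split; first by lia.
    rewrite ltn_neqAle h2 andbT; apply/eqP => e; apply: np2.
    by exists a.+1; rewrite /next_count.
  case: ifP => _; rewrite ?ffunE ?(negbTE ji); exact: (core_dnp c).
have dnE : dn (reported rep s) = (\sum_j dnp (reported rep s) j)%N.
  rewrite /= /next_dn; case: ifP => _; last exact: core_dn c.
  by rewrite sum_update -(core_dn c).
have dnle : (dn (reported rep s) <= t.+1)%N.
  rewrite dnE -sumE; apply: leq_sum => j _.
  case: (dnpE j) => [[-> ->]//|[a [-> /andP[]//]]].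
split => //.
- by have := next_tau_ge (core_tau0 c); have := core_tau0 c; rewrite /=; lia.
- rewrite /= /next_tau; case: ifP => _; first by move: dnle => /=; lia.
  by have := core_tau c; lia.
- rewrite /= /next_tau /boundary; case: ifP => [/andP[_]|].
    by have := core_tau0 c; lia.
  have := core_dn_lt c; rewrite /next_dn; case: (is_pow2 _) => //= _.
  by move/negbT; rewrite -ltnNge.
- move=> j; have := core_bar c j; rewrite /= /next_count !ffunE.
  by case: (rep); rewrite ?ffunE; case: eqP => [->|] //=; lia.
- move=> j; rewrite /reported; case: (rep) => /=; last by rewrite (core_hat c).
  by rewrite !ffunE; case: eqP => // _; rewrite (core_hat c).
- move=> j jA; rewrite /= ffunE; case: eqP => [je|_]; last exact: (core_unvisited c jA).
  by have := jA (hist s); rewrite -/(cur s) je eqxx.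
Qed.


Lemma core_resampling t pold (s0 s : state R k) :
  core t pold s0 -> resampling (srv_p s0) pold (enum 'I_k) s0 s -> core t (srv_p s) s.
Proof.
move=> c rs; split.
- by rewrite (rs_site rs) (rs_srv rs) (core_site c).
- by rewrite (rs_srv rs) (rs_tau rs) (core_p c).
- by rewrite (rs_tau rs) (core_tau0 c).
- by rewrite (rs_tau rs) (core_tau c).
- by rewrite (rs_dn rs) (rs_dnp rs) (core_dn c).
- by rewrite (rs_dn rs) (rs_tau rs) (core_dn_lt c).
- by rewrite (rs_cnt rs) (core_cnt c).
- by rewrite (rs_cnt rs) (rs_dnp rs); exact: core_dnp c.
- by move=> j; rewrite (rs_cnt rs); apply: leq_trans (rs_bar rs j) (core_bar c j).
- by move=> j; rewrite (rs_hat rs) mem_enum /= (rs_srv rs).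
- by move=> j; rewrite (rs_cnt rs); exact: core_unvisited c j.
Qed.

End Protocol.

Lemma dbind_retl (R : realType) (T U : choiceType) (x : T) (g : T -> dist R U) :
  (forall y, nonneg (g y)) -> dbind (dret R x) g = g x.
Proof.
move=> g0; apply/funext => z; rewrite /dbind.
by rewrite -(Ex_ret x (f := fun y => g y z))// => y; exact: g0.
Qed.

(** * Exponential moments of the resampled estimates *)

Section ExponentialMoments.
Variable R : realType.
Implicit Types p th : R.

(* The bound K e^(-th (b - 1)) is propagated by the recursion
   phi (b + 1) = p e^(-th (b - 1 + 1/p)) + (1 - p) phi b, because K (1 - th/p) = e^(-th/p);
   the truncation at 0 only enters through phi 1 = 1 <= K. *)
Lemma Ex_geom_hat p th (b : nat) : 0 < p <= 1 -> 0 <= th -> th < p ->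
  (Ex (geom_d p) (fun g => (expR (- th * hat_of p (b.+1 - g)))%:E) <=
   (expR (- (th / p)) / (1 - th / p) * expR (- th * b%:R))%:E)%E.
Proof.
move=> /andP[p0 p1] th0 thp; have hp : 0 <= p <= 1 by rewrite ltW.
have m1 : mass1 (geom_d p) by apply: mass1_geom; rewrite p0.
have l1 : 0 < 1 - th / p by rewrite subr_gt0 ltr_pdivrMr// mul1r.
set K := expR _ / _.
have KE : K * (1 - th / p) = expR (- (th / p)) by rewrite /K divfK// gt_eqF.
have K1 : 1 <= K.
  by rewrite /K ler_pdivlMr// mul1r; have := expR_ge1Dx (- (th / p)).
have f0 b' g : (0 <= (expR (- th * hat_of p (b' - g)))%:E)%E by rewrite lee_fin expR_ge0.
elim: b => [|b IH].
  rewrite mulr0 expR0 mulr1; apply: le_trans (_ : (1 <= _)%E); last by rewrite lee_fin.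
  rewrite (_ : (fun _ => _) = (fun g : nat => (expR (- th * hat_of p (1 - g)))%:E))//.
  rewrite Ex_geom_shift//= subnn /hat_of eqxx mulr0 expR0.
  by rewrite m1 !mule1 -EFinD addrC subrK.
rewrite Ex_geom_shift// subSS subn0 {1}/hat_of /=.
rewrite (_ : (fun _ => _) = fun g => (expR (- th * hat_of p (b.+1 - g)))%:E)//.
apply: (@le_trans _ _ ((p * expR (- th * (b.+1%:R - 1 + p^-1)))%:E +
   ((1 - p) * (K * expR (- th * b%:R)))%:E)%E).
  rewrite EFinM; apply: leeD; first by [].
  by rewrite EFinM; apply: lee_wpmul2l => //; rewrite lee_fin subr_ge0.
rewrite -EFinD lee_fin.
have -> : - th * (b.+1%:R - 1 + p^-1) = - th * b%:R + - (th / p).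
  by rewrite -natr1; field; rewrite gt_eqF.
have -> : - th * b.+1%:R = - th * b%:R + - th by rewrite -natr1; ring.
rewrite !expRD -KE; set E := expR (- th * b%:R).
have E0 : 0 < E by exact: expR_gt0.
have -> : p * (E * (K * (1 - th / p))) + (1 - p) * (K * E) = K * E * (1 - th).
  by field; rewrite gt_eqF.
have K0 : 0 < K by exact: lt_le_trans K1.
rewrite mulrA ler_pM2l; last exact: mulr_gt0.
exact: expR_ge1Dx.
Qed.

(** With d = 1/p - 1/q the left side is e^(-th/p) (1 + th d / (1 - th/p)). The first order part th d
    is exactly the shift from 1/p back to 1/q, which is the unbiasedness of the thinning; the excess
    1/(1 - lam) - 1 = lam/(1 - lam) is the second order cost. *)
Lemma thinned_hat_bound p q th lam : 0 < p -> p <= q -> 0 <= th -> th <= lam * p -> lam < 1 ->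
  (p / q) * expR (- (th / p)) + (1 - p / q) * (expR (- (th / p)) / (1 - th / p)) <=
  expR (- (th / q)) * expR (th * (lam / (1 - lam)) * (p^-1 - q^-1)).
Proof.
move=> p0 pq th0 thp lam1; have q0 : 0 < q by exact: lt_le_trans pq.
have thp' : th / p <= lam by rewrite ler_pdivrMr.
have l1 : 0 < 1 - th / p by lra.
have pth : 0 < p - th.
  by have : 0 < (1 - lam) * p; [rewrite mulr_gt0// subr_gt0 | lra].
have d0 : 0 <= p^-1 - q^-1 by rewrite subr_ge0 lef_pV2 ?posrE.
have -> : (p / q) * expR (- (th / p)) + (1 - p / q) * (expR (- (th / p)) / (1 - th / p)) =
  expR (- (th / p)) * (1 + th * (p^-1 - q^-1) / (1 - th / p)).
  by field; rewrite !gt_eqF.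
apply: le_trans (_ : expR (- (th / p)) * expR (th * (p^-1 - q^-1) / (1 - th / p)) <= _).
  by rewrite ler_pM2l ?expR_gt0// expR_ge1Dx.
rewrite -!expRD ler_expR.
have -> : - (th / q) = - (th / p) + th * (p^-1 - q^-1) by ring.
rewrite -addrA lerD2l.
have -> : th * (p^-1 - q^-1) + th * (lam / (1 - lam)) * (p^-1 - q^-1) =
  th * (p^-1 - q^-1) / (1 - lam) by field; lra.
by rewrite ler_wpM2l ?mulr_ge0// lef_pV2 ?posrE//; lra.
Qed.

End ExponentialMoments.

Section ResampleMoment.
Variables (R : realType) (k : nat).
Variables (p pold th lam : R) (Q : pred 'I_k).
Hypotheses (p0 : 0 < p) (pp : p <= pold) (p1 : p <= 1).
Hypotheses (th0 : 0 <= th) (thp : th <= lam * p) (lam1 : lam < 1).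
Implicit Types s : state R k.

Definition exp_hat s : \bar R := (expR (- th * \sum_(j | Q j) hatn s j))%:E.

(** Proportional to an increment of 1/p, so that the costs of successive resamplings telescope. *)
Let cost : R := th * (lam / (1 - lam)) * (p^-1 - pold^-1).

Let lam0 : 0 <= lam.
Proof. by rewrite -(pmulr_lge0 _ p0); exact: le_trans thp. Qed.

Let cost_ge0 : 0 <= cost.
Proof.
have pold0 : 0 < pold by exact: lt_le_trans pp.
apply: mulr_ge0; last by rewrite subr_ge0 lef_pV2 ?posrE.
by apply: mulr_ge0 => //; apply: divr_ge0 => //; rewrite subr_ge0 ltW.
Qed.

Lemma exp_hat_ge0 s : (0 <= exp_hat s)%E.
Proof. by rewrite lee_fin expR_ge0. Qed.

(** Only the term of site [i] changes. Failure of the coin keeps the count with probability p/pold,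
    success subtracts a geometric variable, and [thinned_hat_bound] combines the two. *)
Lemma Ex_resample_one_hat i s : hatn s i = hat_of pold (barn s i) ->
  (Ex (resample_one p pold i s) exp_hat <=
   exp_hat s * (expR (if Q i then cost else 0))%:E)%E.
Proof.
move=> hi; have hb : 0 <= 1 - p / pold <= 1 by have := ratio_in01 p0 pp; lra.
have hg : 0 <= p <= 1 by rewrite ltW.
have m1 : mass1 (geom_d p) by apply: mass1_geom; rewrite p0.
pose S := \sum_(j | Q j && (j != i)) hatn s j.
have sumE b g : \sum_(j | Q j) hatn (resample_site p i b g s) j =
    S + (if Q i then hat_of p (barn s i - (if b then g else 0)) else 0).
  have [Qi|Qi] := boolP (Q i).
    rewrite (bigD1 i)//= ffunE eqxx addrC; congr (_ + _).
    by apply: eq_bigr => j /andP[_ /negbTE ji]; rewrite ffunE ji.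
  rewrite addr0 /S; apply: eq_big => j; last first.
    by move=> Qj; rewrite /= ffunE; case: eqP => // ji; rewrite -ji Qj in Qi.
  by case: eqP => [->|]; rewrite ?(negbTE Qi) ?andbT.
have sumE0 : \sum_(j | Q j) hatn s j = S + (if Q i then hatn s i else 0).
  have [Qi|Qi] := boolP (Q i); first by rewrite (bigD1 i)//= addrC.
  rewrite addr0 /S; apply: eq_bigl => j.
  by case: eqP => [->|]; rewrite ?(negbTE Qi) ?andbT.
have -> : Ex (resample_one p pold i s) exp_hat =
    ((expR (- th * S))%:E * Ex (bernoulli_d (1 - p / pold)) (fun b => Ex (geom_d p)
     (fun g => (expR (- th * (if Q i then hat_of p (barn s i - (if b then g else 0)) else 0)))%:E)))%E.
  rewrite /resample_one Ex_bind; last 3 first.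
  - exact: bernoulli_ge0.
  - by move=> b; apply: dbind_ge0 => [|g]; [exact: geom_ge0 | exact: dret_ge0].
  - exact: exp_hat_ge0.
  rewrite -ExZ; last 3 first.
  - exact: bernoulli_ge0.
  - by rewrite lee_fin expR_ge0.
  - by move=> b; apply: Ex_ge0 => [|g]; [exact: geom_ge0 | rewrite lee_fin expR_ge0].
  congr Ex; apply/funext => b; rewrite Ex_bind; last 3 first.
  - exact: geom_ge0.
  - by move=> g; exact: dret_ge0.
  - exact: exp_hat_ge0.
  rewrite -ExZ; last 3 first.
  - exact: geom_ge0.
  - by rewrite lee_fin expR_ge0.
  - by move=> g; rewrite lee_fin expR_ge0.
  congr Ex; apply/funext => g; rewrite Ex_ret; last exact: exp_hat_ge0.
  by rewrite /exp_hat sumE -EFinM -expRD mulrDr.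
rewrite {1}/exp_hat sumE0 mulrDr expRD EFinM -muleA.
apply: lee_wpmul2l; first by rewrite lee_fin expR_ge0.
have triv : (Ex (bernoulli_d (1 - p / pold)) (fun b => Ex (geom_d p)
     (fun g => (expR (- th * 0))%:E)) = 1)%E.
  rewrite mulr0 expR0 (_ : (fun _ => _) = fun=> 1%E); first exact: mass1_bernoulli.
  by apply/funext => b; exact: m1.
have [Qi|Qi] := boolP (Q i); last by rewrite triv mulr0 expR0 mule1.
(* A count 0 stays 0, so its factor is 1, and nonnegativity of the cost suffices. *)
rewrite hi; case: (barn s i) => [|b].
  rewrite (_ : (fun _ => _) = (fun=> Ex (geom_d p) (fun=> (expR (- th * 0))%:E))); last first.
    by apply/funext => b; congr Ex; apply/funext => g; rewrite sub0n.
  by rewrite triv /hat_of eqxx mulr0 expR0 mul1e lee_fin -expR0 ler_expR.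
rewrite Ex_bernoulli//; last first.
  by move=> c; apply: Ex_ge0 => [|g]; [exact: geom_ge0 | rewrite lee_fin expR_ge0].
rewrite (Ex_cst (geom_ge0 hg) m1); last by rewrite lee_fin expR_ge0.
have pth : th < p by rewrite (le_lt_trans thp)// gtr_pMl.
have pold0 : 0 < pold by exact: lt_le_trans pp.
apply: (@le_trans _ _ ((1 - p / pold)%:E *
   (expR (- (th / p)) / (1 - th / p) * expR (- th * b%:R))%:E +
   (1 - (1 - p / pold))%:E * (expR (- th * hat_of p b.+1))%:E)%E).
  apply: leeD => //; apply: lee_wpmul2l; first by rewrite lee_fin; case/andP: hb.
  by apply: Ex_geom_hat => //; rewrite p0.
rewrite -!EFinM -EFinD lee_fin /hat_of /=.
have hatE (q : R) : - th * (b.+1%:R - 1 + q^-1) = - th * b%:R + - (th / q).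
  by rewrite -natr1; ring.
rewrite !hatE !expRD; set E := expR (- th * b%:R).
rewrite -[leRHS]mulrA [leLHS](_ : _ = E * ((p / pold) * expR (- (th / p)) +
  (1 - p / pold) * (expR (- (th / p)) / (1 - th / p)))); last by ring.
by rewrite ler_pM2l ?expR_gt0//; exact: thinned_hat_bound.
Qed.

(** One factor per site of [Q]. As the enumeration has no repetition, a site still has its old
    estimate when its turn comes. *)
Lemma Ex_resample_hat s : (forall j, hatn s j = hat_of pold (barn s j)) ->
  (Ex (resample_all p pold s) exp_hat <=
   exp_hat s * (expR (cost * #|Q|%:R))%:E)%E.
Proof.
move=> hatE; rewrite resample_allE.
have -> : #|Q| = count Q (enum 'I_k) by rewrite cardE enumT -size_filter.
elim: (enum 'I_k) (enum_uniq 'I_k) => [_|i l IH /= /andP[il ul]] /=.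
  by rewrite mulr0 expR0 mule1 Ex_ret//; exact: exp_hat_ge0.
rewrite Ex_bind; last 3 first.
- exact: resample_list_ge0.
- by move=> s'; exact: resample_one_ge0.
- exact: exp_hat_ge0.
apply: (@le_trans _ _ (Ex (resample_list p pold s l)
   (fun s' => (expR (if Q i then cost else 0))%:E * exp_hat s')%E)).
  refine (le_Ex (resample_list_ge0 s p0 pp p1 l) (@supp_resample_list _ _ _ _ s p0 pp p1 l) _).
  move=> s' rs; rewrite muleC; apply: Ex_resample_one_hat.
  by rewrite (rs_hat rs) (negbTE il) hatE (rs_barN rs).
rewrite ExZ; last 3 first.
- exact: resample_list_ge0.
- by rewrite lee_fin expR_ge0.
- exact: exp_hat_ge0.
apply: (@le_trans _ _ ((expR (if Q i then cost else 0))%:E *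
   (exp_hat s * (expR (cost * (count Q l)%:R))%:E))%E).
  by apply: lee_wpmul2l; [rewrite lee_fin expR_ge0 | exact: IH].
rewrite muleCA -EFinM -expRD natrD mulrDr.
by case: (Q i); rewrite ?mulr1 ?mulr0.
Qed.

End ResampleMoment.

(** * The law of the protocol *)

Section Step.
Variables (R : realType) (k : nat) (eps : R) (A : seq R -> 'I_k).
Hypotheses (k0 : (0 < k)%N) (eps0 : 0 < eps) (epsk : eps <= (Num.sqrt k%:R)^-1).
Implicit Types (s : state R k) (p : R) (rep : bool).

Local Notation core := (core eps A).
Local Notation valid := (valid eps A).
Local Notation reported := (reported eps A).
Local Notation resampled := (resampled eps A).
Local Notation next_p := (next_p eps A).
Local Notation next_tau := (next_tau A).
Local Notation boundary := (boundary A).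

Lemma next_p_le t p s : core t p s -> 0 < next_p s /\ next_p s <= srv_p s /\ next_p s <= 1.
Proof.
move=> c; rewrite /next_p (core_p c) new_p_gt0 new_p_le1; split => //; split => //.
by rewrite new_p_le ?(core_tau0 c)// next_tau_ge ?(core_tau0 c).
Qed.

Lemma resampled_ge0 t p rep s : core t p s -> nonneg (resampled rep s).
Proof.
move=> /next_p_le [h1 [h2 h3]]; rewrite /resampled; case: ifP => _.
  by rewrite resample_allE; exact: resample_list_ge0.
exact: dret_ge0.
Qed.

Lemma mass1_resampled t p rep s : core t p s -> mass1 (resampled rep s).
Proof.
move=> /next_p_le [h1 [h2 h3]]; rewrite /resampled; case: ifP => _.
  by rewrite resample_allE; exact: mass1_resample_list.
exact: mass1_ret.
Qed.

(** Brings all branches of [step] to one form. A boundary with new p equal to 1 leaves [site_p]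
    alone, which agrees with [reported] because p never increases and hence was already 1. *)
Lemma stepE t s : valid t s -> step eps A s =
  dbind (bernoulli_d (srv_p s)) (fun rep =>
    dbind (resampled rep s) (fun s2 => dret R (publish s2))).
Proof.
move=> i; have c := valid_core i; have [h1 [h2 h3]] := next_p_le c.
rewrite /step (core_site c); congr dbind; apply/funext => rep.
have ret0 (s2 : state R k) : nonneg (dret R (publish s2)) by exact: dret_ge0.
rewrite /resampled /reported -/(cur A s) -/(next_count A s) -/(next_dn A s) -/(boundary s).
have [b|b] := boolP (boundary s); last first.
  by rewrite /= dbind_retl// /next_p /next_tau (negbTE b) -(core_p c).
have nt : next_tau s = next_dn A s by rewrite /next_tau b.
rewrite /next_p nt /=; case: ifP => // /negbT; rewrite -leNgt => p1.
rewrite dbind_retl//; congr (dret R (publish (State _ _ _ _ _ _ _ _ _ _))).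
have := core_srv_p c; have : next_p s = 1.
  by apply/eqP; rewrite eq_le h3 /next_p nt.
rewrite -[new_p _ _ _](_ : next_p s = _); last by rewrite /next_p nt.
by move=> e; rewrite e; move: h2; rewrite e; lra.
Qed.

(** Either p is unchanged and a possible redraw is trivial, or p at least halves, which forces a
    boundary and a value below 1, hence a real resampling. *)
Lemma resampled_cases t rep s : valid t s ->
  (next_p s = srv_p s /\ forall f, (forall s, 0 <= f s)%E ->
    Ex (resampled rep s) f = f (reported rep s)) \/
  (next_p s <= srv_p s / 2 /\
    resampled rep s = resample_all (next_p s) (srv_p s) (reported rep s)).
Proof.
move=> i; have c := valid_core i; have [h1 [h2 h3]] := next_p_le c.
have : next_p s = srv_p s \/ next_p s <= srv_p s / 2.
  rewrite /next_p (core_p c); apply: new_p_halves => //; first exact: core_tau0 c.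
  exact: next_tau_ge (core_tau0 c).
case=> [e|h]; [left|right]; split => //.
  move=> f f0; rewrite /resampled; case: ifP => _; last exact: Ex_ret.
  have := core_hat (core_reported rep c); rewrite -e.
  by move=> hE; rewrite Ex_resample_trivial.
have sp := core_srv_p c.
rewrite /resampled ifT//; apply/andP; split; last by lra.
apply/negPn/negP => nb; move: h; rewrite /next_p /next_tau (negbTE nb) -(core_p c); lra.
Qed.

Definition outcome t rep s s' : Prop :=
  [/\ core t.+1 (srv_p s') s', cnt s' = cnt (reported rep s), hist s' = hist s,
      est s' = est (reported rep s) & srv_p s' = next_p s].

Lemma supp_resampled t rep s : valid t s -> supp (resampled rep s) (outcome t rep s).
Proof.
move=> i; have c := valid_core i; have [h1 [h2 h3]] := next_p_le c.
have cr := core_reported rep c.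
rewrite /resampled; case: ifP => [_|b].
  rewrite resample_allE => s' /(supp_resample_list h1 h2 h3) rs; split.
  - by apply: core_resampling cr _.
  - exact: rs_cnt rs.
  - exact: rs_hist rs.
  - exact: rs_est rs.
  - exact: rs_srv rs.
apply: supp_ret; split => //=.
have -> // : next_p s = srv_p s.
move/negbT: b; rewrite negb_and => /orP[b|].
  by rewrite /next_p /next_tau (negbTE b) -(core_p c).
rewrite -leNgt => p1; have := core_srv_p c; lra.
Qed.

Lemma Ex_resampled_le t rep s f (c : \bar R) : valid t s -> (0 <= c)%E ->
  (forall s', outcome t rep s s' -> (f s' <= c)%E) -> (Ex (resampled rep s) f <= c)%E.
Proof.
move=> v; have cs := valid_core v.
exact: (Ex_le_cst (resampled_ge0 rep cs) (mass1_resampled rep cs) (@supp_resampled _ rep _ v)).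
Qed.

Lemma supp_step t s : valid t s -> supp (step eps A s) (valid t.+1).
Proof.
move=> i; rewrite (stepE i).
apply: (@supp_bind _ _ _ _ _ (fun=> True)); first exact: suppT.
move=> rep _; apply: (supp_bind (@supp_resampled _ rep _ i)) => s' [c' _ hE _ _].
apply: supp_ret; split => //=.
- by case: c'.
- by rewrite size_rcons hE (valid_size i).
- by rewrite last_rcons.
Qed.

Lemma step_ge0 t s : valid t s -> nonneg (step eps A s).
Proof.
move=> i; rewrite (stepE i); have c := valid_core i; have sp := core_srv_p c.
apply: dbind_ge0; first by apply: bernoulli_ge0; lra.
move=> rep; apply: dbind_ge0; first exact: resampled_ge0 c.
by move=> s'; exact: dret_ge0.
Qed.

Lemma mass1_step t s : valid t s -> mass1 (step eps A s).
Proof.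
move=> i; rewrite (stepE i); have c := valid_core i; have sp := core_srv_p c.
apply: (@mass1_bind _ _ _ _ _ (fun=> True)) => //.
- by apply: bernoulli_ge0; lra.
- move=> rep; apply: dbind_ge0; first exact: resampled_ge0 c.
  by move=> s'; exact: dret_ge0.
- by apply: mass1_bernoulli; lra.
move=> rep _; apply: (@mass1_bind _ _ _ _ _ (fun=> True)) => //.
- exact: resampled_ge0 c.
- by move=> s'; exact: dret_ge0.
- exact: mass1_resampled c.
by move=> s' _; exact: mass1_ret.
Qed.

Lemma Ex_step_le t s f (X1 X0 X : R) : valid t s -> (forall s, 0 <= f s)%E ->
  (Ex (resampled true s) (fun s' => f (publish s')) <= X1%:E)%E ->
  (Ex (resampled false s) (fun s' => f (publish s')) <= X0%:E)%E ->
  srv_p s * X1 + (1 - srv_p s) * X0 <= X ->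
  (Ex (step eps A s) f <= X%:E)%E.
Proof.
move=> i f0 h1 h0 hX; rewrite (stepE i); have c := valid_core i.
have sp := core_srv_p c; have sp' : 0 <= srv_p s <= 1 by lra.
have r0 rep : nonneg (dbind (resampled rep s) (fun s2 => dret R (publish s2))).
  apply: dbind_ge0; first exact: resampled_ge0 c.
  by move=> s'; exact: dret_ge0.
have E rep : Ex (dbind (resampled rep s) (fun s2 => dret R (publish s2))) f =
    Ex (resampled rep s) (fun s' => f (publish s')).
  rewrite Ex_bind//; [|exact: resampled_ge0 c | by move=> s'; exact: dret_ge0].
  by congr Ex; apply/funext => s'; rewrite Ex_ret.
rewrite Ex_bind//; last exact: bernoulli_ge0.
rewrite Ex_bernoulli//; last by move=> rep; exact: Ex_ge0.
rewrite !E; apply: (@le_trans _ _ ((srv_p s)%:E * X1%:E + (1 - srv_p s)%:E * X0%:E)%E).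
  by apply: leeD; apply: lee_wpmul2l => //; rewrite lee_fin; lra.
by rewrite -!EFinM -EFinD lee_fin.
Qed.

Lemma valid_init : valid 0 (init_state R k).
Proof.
split => //; split => //=.
- by rewrite new_p1.
- by rewrite big1// => j _; rewrite ffunE.
- by rewrite big1// => j _; rewrite ffunE.
- by move=> j; left; rewrite !ffunE.
- by move=> j; rewrite !ffunE.
- by move=> j _; rewrite ffunE.
Qed.

Lemma law_facts n :
  [/\ nonneg (law eps A n), supp (law eps A n) (valid n) & mass1 (law eps A n)].
Proof.
elim: n => [|n [n0 sn mn]] /=.
  by split; [exact: dret_ge0 | exact: supp_ret valid_init | exact: mass1_ret].
split.
- by apply: (dbind_ge0_supp n0 sn) => s; exact: step_ge0.
- by apply: (supp_bind sn) => s; exact: supp_step.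
- apply: (mass1_bind_supp n0 sn _ mn) => s; first exact: step_ge0.
  exact: mass1_step.
Qed.

(** The start is bounded pointwise over the valid states, so nothing about the law before [t0]
    enters. *)
Lemma law_supermartingale (F : nat -> state R k -> \bar R) (t0 N : nat) (B : \bar R) :
  (t0 <= N)%N -> (0 <= B)%E -> (forall t s, 0 <= F t s)%E ->
  (forall t s, (t0 <= t < N)%N -> valid t s -> (Ex (step eps A s) (F t.+1) <= F t s)%E) ->
  (forall s, valid t0 s -> (F t0 s <= B)%E) ->
  (Ex (law eps A N) (F N) <= B)%E.
Proof.
move=> t0N B0 F0 Fstep Fstart; have : (t0 <= N <= N)%N by rewrite t0N leqnn.
elim: {1 2 4 5}N => [|n IH] /andP[t0n nN].
  have -> : 0%N = t0 by lia.
  have [n0 sn mn] := law_facts t0.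
  exact: (Ex_le_cst n0 mn sn).
have [t0n'|nt0] := leqP t0 n; last first.
  have -> : n.+1 = t0 by lia.
  have [n0 sn mn] := law_facts t0.
  exact: (Ex_le_cst n0 mn sn).
have [n0 sn mn] := law_facts n.
rewrite /= (Ex_bind_supp n0 sn)//; last by move=> s; exact: step_ge0.
apply: (@le_trans _ _ (Ex (law eps A n) (F n))); last by apply: IH; lia.
by apply: (le_Ex n0 sn) => s; apply: Fstep; rewrite t0n'.
Qed.

End Step.

(** * A single site *)

Section SingleSite.
Variables (R : realType) (k : nat) (eps : R) (i0 : 'I_k).
Hypotheses (k0 : (0 < k)%N) (eps0 : 0 < eps) (epsk : eps <= (Num.sqrt k%:R)^-1).
Implicit Types (s : state R k).

Let A : seq R -> 'I_k := fun=> i0.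

Lemma unvisited_hat t p s (B : seq R -> 'I_k) j : core eps B t p s ->
  (forall h, B h != j) -> hatn s j = 0.
Proof.
move=> c /(core_unvisited c) cj; rewrite (core_hat c) /hat_of.
by have := core_bar c j; rewrite cj leqn0 => /eqP ->.
Qed.

Lemma est_single_site t s : valid eps A t s ->
  est (reported eps A true s) = t%:R + (srv_p s)^-1.
Proof.
move=> v; have c := valid_core v.
have nA j : j != i0 -> forall h, A h != j by move=> ji h; rewrite eq_sym.
have ct : cnt s i0 = t.
  rewrite -(core_cnt c) (bigD1 i0)//= big1 ?addn0// => j /nA; exact: core_unvisited c j.
rewrite /= (bigD1 i0)//= big1 ?addr0 => [|j ji].
  by rewrite ffunE eqxx /next_count /cur ct -natr1; ring.
by rewrite ffunE /cur (negbTE ji) (unvisited_hat c (nA _ ji)).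
Qed.

(** One report among the last [L] events is enough, since the estimate stays put until the next
    report, which is just as large. The potential [F] bounds the probability that no report comes in
    the remaining time. *)
Lemma single_site_overestimate (N L : nat) (q g : R) : (L <= N)%N -> 1 <= q ->
  (forall t s, (N - L <= t < N)%N -> valid eps A t s ->
     q^-1 <= srv_p s /\ g <= (srv_p s)^-1) ->
  ((1 - (1 - q^-1) ^+ L)%:E <=
   prob (law eps A N) [set s : state R k | ((N - L)%:R + g <= est s)%R])%E.
Proof.
move=> LN q1 Hp; set E0 := (N - L)%:R + g.
have a0 : 0 <= 1 - q^-1 by rewrite subr_ge0 invf_le1//; lra.
pose F t s : \bar R := (if est s < E0 then (1 - q^-1) ^+ (N - t) else 0)%:E.
have F0 t s : (0 <= F t s)%E by rewrite lee_fin; case: ifP => // _; exact: exprn_ge0.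
have [n0 sn mn] := law_facts A k0 eps0 epsk N.
apply: (@prob_ge _ _ _ _ _ (F N) _ n0 mn sn) => //.
  by move=> s _ /negP; rewrite -ltNge /F => ->; rewrite subnn expr0.
apply: (law_supermartingale k0 eps0 epsk (t0 := (N - L)%N)) => //.
- exact: leq_subr.
- by rewrite lee_fin exprn_ge0.
- move=> t s tN v; have c := valid_core v.
  have [pq pg] := Hp t s tN v.
  have sp := core_srv_p c.
  apply: (Ex_step_le (X1 := 0)
    (X0 := if est s < E0 then (1 - q^-1) ^+ (N - t.+1) else 0) k0 eps0 v) => //.
  + apply: (Ex_resampled_le k0 eps0 v) => // s' [_ _ _ es' _].
    rewrite /F /= es' (est_single_site v) ifF//; apply/negbTE; rewrite -leNgt /E0.
    by apply: lerD pg; rewrite ler_nat; case/andP: tN.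
  + apply: (Ex_resampled_le k0 eps0 v) => // [|s' [_ _ _ es' _]].
      by rewrite lee_fin; case: ifP => // _; exact: exprn_ge0.
    by rewrite /F /= es' /=.
  + rewrite mulr0 add0r; case: ifP; rewrite ?mulr0// => _.
    have -> : (N - t = (N - t.+1).+1)%N by lia.
    by rewrite exprS ler_wpM2r ?exprn_ge0//; lra.
- move=> s v; rewrite lee_fin subKn//; case: ifP => // _; exact: exprn_ge0.
Qed.

End SingleSite.

(** * The round-robin adversary *)

Section Changes.
Variable R : realType.
Implicit Types h : seq R.

(** The value 0 preceding the first entry is the initial estimate. *)
Definition changes h : nat := count id (pairmap (fun x y => x != y) 0 h).

(** Here [c] is the position of the last change seen and [n] the number of entries read. Positions
    start at 1, so the result is the true event count at the last change, and 0 if there was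
    none. *)
Fixpoint last_change_from (x : R) (c n : nat) h : nat :=
  if h is y :: h' then last_change_from y (if x != y then n.+1 else c) n.+1 h' else c.

Definition last_change h : nat := last_change_from 0 0 0 h.

Lemma changes_rcons h x : changes (rcons h x) = (changes h + (last 0%R h != x))%N.
Proof. by rewrite /changes -cats1 pairmap_cat count_cat /= addn0. Qed.

Lemma last_change_rcons h x :
  last_change (rcons h x) = if last 0 h != x then (size h).+1 else last_change h.
Proof.
rewrite /last_change; have gen z c n : last_change_from z c n (rcons h x) =
    if last z h != x then (n + size h).+1 else last_change_from z c n h.
  elim: h z c n => [|y h IH] z c n /=; first by rewrite addn0.
  by rewrite IH addSnnS.
by rewrite gen.
Qed.

Lemma changes_take_le h t : (changes (take t h) <= changes h)%N.
Proof.
by rewrite -{2}(cat_take_drop t h) /changes pairmap_cat count_cat leq_addr.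
Qed.

Lemma take_rcons_le h x t : (t <= size h)%N -> take t (rcons h x) = take t h.
Proof. by move=> th; rewrite -cats1 takel_cat. Qed.

Definition recent_changes (t : nat) h : nat := (changes h - changes (take t h))%N.

Lemma recent_changes_rcons t h x : (t <= size h)%N ->
  recent_changes t (rcons h x) = (recent_changes t h + (last 0%R h != x))%N.
Proof.
move=> th; rewrite /recent_changes take_rcons_le// changes_rcons.
by have := changes_take_le h t; lia.
Qed.

Lemma last_change_gt h t : (changes (take t h) < changes h)%N -> (t < last_change h)%N.
Proof.
elim/last_ind: h => [//|h x IH].
have [ht|ht] := leqP (size h).+1 t; first by rewrite take_oversize ?size_rcons// ltnn.
rewrite take_rcons_le; last by lia.
rewrite changes_rcons last_change_rcons; case: eqP => //= _.
by rewrite addn0.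
Qed.

End Changes.

Section RoundRobin.
Variables (R : realType) (k : nat) (eps : R) (m : nat).
Hypotheses (k0 : (0 < k)%N) (eps0 : 0 < eps) (epsk : eps <= (Num.sqrt k%:R)^-1).
Implicit Types (s : state R k) (h : seq R).

(** The outer reduction modulo k only serves to form an ordinal; it is the identity for 0 < m <=
    k. *)
Definition round_robin h : 'I_k := Ordinal (ltn_pmod (changes h %% m) k0).

Local Notation A := round_robin.

Lemma val_round_robin h : (0 < m <= k)%N -> round_robin h = (changes h %% m)%N :> nat.
Proof.
by move=> /andP[m0 mk]; rewrite /= modn_small// (leq_trans _ mk)// ltn_pmod.
Qed.

(* A report leaves the published estimate unchanged, and is thus missed by the
   adversary, exactly when the gap is 0. The gap is negative after every report and
   decreases by 1 at every silent event. *)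
Definition blind_gap s : R :=
  est s - (\sum_j hatn s j - hatn s (cur A s) + (cnt s (cur A s))%:R + (srv_p s)^-1).

(** Weight 2 leaves room for one missed report. A negative gap stays negative until p changes, so
    weight 1 is then enough. *)
Definition blind_weight s : R := if blind_gap s < 0 then 1 else 2.

Lemma blind_weight_bounds s : 1 <= blind_weight s <= 2.
Proof. by rewrite /blind_weight; case: ifP => _; lra. Qed.

Lemma sum_hat_reported t p s : core eps A t p s ->
  \sum_j hatn (reported eps A true s) j =
  \sum_j hatn s j - hatn s (cur A s) + (cnt s (cur A s))%:R + (srv_p s)^-1.
Proof.
move=> c; rewrite (bigD1 (cur A s))//= ffunE eqxx [in RHS](bigD1 (cur A s))//=.
under eq_bigr => j /negbTE ji do rewrite ffunE ji.
by rewrite /next_count -natr1; ring.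
Qed.

Lemma est_reported_gap t p s : core eps A t p s ->
  est (reported eps A true s) = est s - blind_gap s.
Proof.
move=> c; rewrite /blind_gap -(sum_hat_reported c) /=; ring.
Qed.

(** After a report [est] is the sum of the estimates, so the gap is hat n - n - 1/p at the next
    site, whichever it is, and hat n is either 0 or at most n - 1 + 1/p. *)
Lemma blind_weight_report t s : valid eps A t s -> next_p eps A s = srv_p s ->
  blind_weight (publish (reported eps A true s)) = 1.
Proof.
move=> v e; have c := core_reported true (valid_core v).
rewrite /blind_weight ifT// /blind_gap /publish.
set i := cur A _; rewrite [est _]/= [hatn _]/= [cnt _]/= [srv_p _]/=.
have := core_bar c i; have := core_hat c i; have [sp _] := andP (core_srv_p (valid_core v)).
have p0 : 0 < (srv_p s)^-1 by rewrite invr_gt0.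
rewrite /= e => -> bi; set X := \sum_(j < k) _.
suff : hat_of (srv_p s) (barn (reported eps A true s) i) <
  (cnt (reported eps A true s) i)%:R + (srv_p s)^-1 by rewrite /=; lra.
move: bi; rewrite -(ler_nat R); rewrite /hat_of; case: eqP => [->|_] bi; last by lra.
by apply: (lt_le_trans p0); rewrite lerDr ler0n.
Qed.

Lemma blind_weight_silent t s : valid eps A t s -> next_p eps A s = srv_p s ->
  blind_gap (publish (reported eps A false s)) = blind_gap s - 1.
Proof.
move=> v e; rewrite /blind_gap /publish /= e.
have cE : round_robin (rcons (hist s) (est s)) = cur A s.
  by apply/val_inj; rewrite /= changes_rcons (valid_est v) eqxx addn0.
rewrite /cur /= cE ffunE eqxx /next_count -natr1; ring.
Qed.

End RoundRobin.

(** * The number of visible reports in a window *)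

Section CountingChanges.
Variables (R : realType) (k : nat) (eps : R) (m : nat).
Hypotheses (k0 : (0 < k)%N) (eps0 : 0 < eps) (epsk : eps <= (Num.sqrt k%:R)^-1).
Variables (N t1 : nat) (q B : R).
Local Notation A := (round_robin m k0).
Hypotheses (t1N : (t1 <= N)%N) (q1 : 1 <= q) (B0 : 0 <= B).
Hypothesis p_lb : forall t s, (t1 <= t <= N)%N -> valid eps A t s -> q^-1 <= srv_p s.
Hypothesis p_ub : forall s, valid eps A t1 s -> srv_p s <= B / q.
Implicit Types (s : state R k) (h : seq R).

(** A visible report has probability at least 1/q and halves the potential, so one event contributes
    a factor of at most 1 - 1/(2q). *)
Let a : R := 1 - (2 * q)^-1.

(* A real resampling at least halves [srv_p s], which pays for the weight
   returning from 1 to 2. *)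
Definition change_potential t s : R :=
  `|srv_p s| * q * blind_weight m k0 s * 2^-1 ^+ recent_changes t1 (hist s) * a ^+ (N - t).

Let q0 : 0 < q. Proof. exact: lt_le_trans q1. Qed.

Let a_bounds : 2^-1 <= a <= 1.
Proof.
have h : (2 * q)^-1 <= 2^-1 by rewrite lef_pV2 ?posrE ?mulr_gt0// ler_peMr//.
have h' : 0 <= (2 * q)^-1 by rewrite invr_ge0 mulr_ge0// ltW.
by rewrite /a; lra.
Qed.

Let half_ge0 j : 0 <= 2^-1 ^+ j :> R.
Proof. by rewrite exprn_ge0// invr_ge0. Qed.

Let a_ge0 j : 0 <= a ^+ j.
Proof. by rewrite exprn_ge0//; have := a_bounds; lra. Qed.

Let w0 s : 0 <= blind_weight m k0 s.
Proof. by have := blind_weight_bounds m k0 s; lra. Qed.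

Lemma change_potential_ge0 t s : 0 <= change_potential t s.
Proof.
by rewrite /change_potential; do 4! [apply: mulr_ge0 => //]; exact: ltW.
Qed.

Lemma change_potential_start s : valid eps A t1 s ->
  change_potential t1 s <= 2 * B * a ^+ (N - t1).
Proof.
move=> v; have [p0 _] := andP (core_srv_p (valid_core v)).
rewrite /change_potential /recent_changes take_oversize ?(valid_size v)// subnn expr0 mulr1.
apply: ler_wpM2r => //; rewrite gtr0_norm// mulrC.
apply: ler_pM => //; first by rewrite mulr_ge0 ?ltW.
  by have := blind_weight_bounds m k0 s; lra.
by rewrite -ler_pdivlMr//; exact: p_ub.
Qed.

Lemma change_potential_end s : valid eps A N s ->
  2^-1 ^+ recent_changes t1 (hist s) <= change_potential N s.
Proof.
move=> v; have [p0 _] := andP (core_srv_p (valid_core v)).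
have pq : 1 <= srv_p s * q.
  by rewrite -ler_pdivrMr// mul1r; apply: (p_lb _ v); rewrite t1N leqnn.
rewrite /change_potential subnn expr0 mulr1 gtr0_norm//.
rewrite ler_peMl// -[leLHS]mulr1; apply: ler_pM => //.
by have := blind_weight_bounds m k0 s; lra.
Qed.

(** [W] bounds the new weight as long as p is unchanged. After a real resampling nothing is known of
    the gap; the weight is bounded by 2, and the halving of p turns this into 1 <= W. *)
Lemma change_potential_branch t s rep W : (t1 <= t)%N -> valid eps A t s -> 1 <= W ->
  (next_p eps A s = srv_p s -> blind_weight m k0 (publish (reported eps A rep s)) <= W) ->
  (Ex (resampled eps A rep s) (fun s' => (change_potential t.+1 (publish s'))%:E) <=
  (srv_p s * q * W * (2^-1 ^+ recent_changes t1 (hist s) *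
     2^-1 ^+ (est s != est (reported eps A rep s))) * a ^+ (N - t.+1))%:E)%E.
Proof.
move=> tt v W1 hW; have c := valid_core v; have [p0 _] := andP (core_srv_p c).
have rc s' : hist s' = hist s -> est s' = est (reported eps A rep s) ->
    2^-1 ^+ recent_changes t1 (hist (publish s')) = 2^-1 ^+ recent_changes t1 (hist s) *
     2^-1 ^+ (est s != est (reported eps A rep s)) :> R.
  move=> hE eE; rewrite /= hE eE recent_changes_rcons ?(valid_size v)//.
  by rewrite exprD (valid_est v).
have [[e ->]|[h _]] := resampled_cases k0 eps0 rep v.
- rewrite lee_fin /change_potential rc//.
  rewrite [srv_p (publish _)]e gtr0_norm//.
  do 2! [apply: ler_wpM2r; first by rewrite ?mulr_ge0].
  by apply: ler_wpM2l; [rewrite mulr_ge0// ltW | exact: hW].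
- by move=> s'; rewrite lee_fin change_potential_ge0.
- apply: (Ex_resampled_le k0 eps0 v); first by rewrite lee_fin !mulr_ge0// ?ltW//; lra.
  move=> s' [c' _ hE eE pE]; rewrite lee_fin /change_potential rc//.
  have [p0' _] := andP (core_srv_p c'); rewrite gtr0_norm//.
  do 2! [apply: ler_wpM2r; first by rewrite ?mulr_ge0].
  rewrite /= pE; have := blind_weight_bounds m k0 (publish s') => wb.
  have np0 : 0 <= next_p eps A s by rewrite -pE ltW.
  apply: (@le_trans _ _ (next_p eps A s * q * 2)).
    by apply: ler_wpM2l; [rewrite mulr_ge0// ltW | lra].
  apply: (@le_trans _ _ (srv_p s * q * 1)); last by rewrite ler_wpM2l// mulr_ge0// ltW.
  by rewrite mulr1 mulrAC ler_wpM2r//; [exact: ltW | lra].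
Qed.

Lemma change_potential_step t s : (t1 <= t < N)%N -> valid eps A t s ->
  (Ex (step eps A s) (fun s' => (change_potential t.+1 s')%:E) <=
   (change_potential t s)%:E)%E.
Proof.
move=> /andP[tt tN] v; have c := valid_core v; have [p0 p1] := andP (core_srv_p c).
have pq : q^-1 <= srv_p s by apply: (p_lb _ v); rewrite tt ltnW.
have wt : next_p eps A s = srv_p s ->
    blind_weight m k0 (publish (reported eps A true s)) <= 1.
  by move=> e; rewrite (blind_weight_report v e).
have bt := change_potential_branch tt v (lexx _) wt.
pose W0 : R := if blind_gap m k0 s <= 0 then 1 else 2.
have bf : next_p eps A s = srv_p s ->
    blind_weight m k0 (publish (reported eps A false s)) <= W0.
  move=> e; rewrite /blind_weight (blind_weight_silent v e) /W0.
  by case: ifP => h1; case: ifP => h2; lra.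
have W01 : 1 <= W0 by rewrite /W0; case: ifP; lra.
have {}bf := change_potential_branch tt v W01 bf.
apply: (Ex_step_le k0 eps0 v _ bt bf).
  by move=> s'; rewrite lee_fin change_potential_ge0.
rewrite (est_reported_gap c) /= eqxx expr0 mulr1 /change_potential.
rewrite gtr0_norm// -(subnSK tN).
set h := 2^-1 ^+ recent_changes t1 _; set b := a ^+ (N - t.+1); rewrite exprS -/b.
set P := srv_p s; have -> : P * (P * q * 1 * (h * 2^-1 ^+ (est s != est s - blind_gap m k0 s)) * b) +
  (1 - P) * (P * q * W0 * h * b) =
  (P * q * h * b) * (P * 2^-1 ^+ (est s != est s - blind_gap m k0 s) + (1 - P) * W0) by ring.
have -> : P * q * blind_weight m k0 s * h * (a * b) = (P * q * h * b) * (blind_weight m k0 s * a).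
  by ring.
have h0 : 0 <= h by exact: half_ge0.
have b0 : 0 <= b by exact: a_ge0.
apply: ler_wpM2l; first by do 3! [apply: mulr_ge0 => //]; exact: ltW.
have aP : 1 - P / 2 <= a.
  by rewrite /a invfM; move: pq; rewrite -/P; lra.
(* Three cases, by the gap. Negative: the report is seen, p/2 + (1 - p) <= a. Zero: the report is
   missed but both branches end with weight 1, and 1 <= 2 a. Positive: p/2 + 2 (1 - p) <= 2 a. *)
rewrite -[X in X != _]subr0 (inj_eq (addrI _)) eqr_opp eq_sym /W0 /blind_weight.
have := a_bounds; case: (ltgtP (blind_gap m k0 s) 0) => _ ab /=; rewrite ?expr1 ?expr0; lra.
Qed.

Lemma change_potential_law :
  (Ex (law eps A N) (fun s => (change_potential N s)%:E) <= (2 * B * a ^+ (N - t1))%:E)%E.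
Proof.
apply: (law_supermartingale k0 eps0 epsk (F := fun t s => (change_potential t s)%:E) t1N).
- by rewrite lee_fin !mulr_ge0.
- by move=> t s; rewrite lee_fin change_potential_ge0.
- exact: change_potential_step.
- by move=> s v; rewrite lee_fin; exact: change_potential_start.
Qed.

End CountingChanges.

(** * The error of the visited sites *)

Section ErrorPotential.
Variables (R : realType) (k : nat) (eps : R) (m : nat).
Hypotheses (k0 : (0 < k)%N) (eps0 : 0 < eps) (epsk : eps <= (Num.sqrt k%:R)^-1).
Hypotheses (m2 : (1 < m)%N) (mk : (m <= k)%N).
Variables (N t0 : nat) (q B th lam gam : R).
Local Notation A := (round_robin m k0).
Implicit Types (s : state R k) (h : seq R) (j : 'I_k).

(* The sites that the adversary has left since time [t0], except the one it is
   visiting now. *)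
Definition finished h j : bool :=
  (j != A h) && has (fun u => u %% m == j)%N (index_iota (changes (take t0 h)) (changes h)).

Definition gain s : R :=
  \sum_(j | finished (hist s) j) (hatn s j - (cnt s j)%:R - gam).

(* Pays for the exponential moments of the future resamplings. *)
Let bonus p : R := lam / (1 - lam) * m%:R / p.

Definition site_term p x : R := expR (- th * (x + bonus p)).

(** [last_change h] is the true count when the published value was computed, so the exponent sees
    the error at that time. Before a full round the sum may contain sites of unknown error, and the
    term is 0. *)
Definition est_term p (y : R) h : R :=
  if (m <= recent_changes t0 h)%N
  then expR (- th * (y - (last_change h)%:R - m%:R * gam + bonus p)) else 0.

(** A maximum and not a sum: a visible report may make both terms as large as the old [site_term].
    The absolute value gives nonnegativity at arbitrary states. *)
Definition error_potential s : R :=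
  `|srv_p s| * q * Num.max (site_term (srv_p s) (gain s)) (est_term (srv_p s) (est s) (hist s)).

Lemma finished_lt h j : finished h j -> (j < m)%N.
Proof.
by move=> /andP[_ /hasP[u _ /eqP <-]]; rewrite ltn_mod ltnW.
Qed.

Lemma sum_lt_m (F : 'I_k -> R) : (forall j, (m <= j)%N -> F j = 0) ->
  \sum_j F j = \sum_(j < k | (j < m)%N) F j.
Proof.
move=> F0; rewrite [LHS](bigID (fun j : 'I_k => (j < m)%N))/= [X in _ + X]big1 ?addr0//.
by move=> j; rewrite -leqNgt => /F0.
Qed.

Lemma sum_const_lt_m (x : R) : \sum_(j < k | (j < m)%N) x = m%:R * x.
Proof.
by rewrite -(big_ord_widen k (fun=> x) mk) sumr_const card_ord mulr_natl.
Qed.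

Lemma card_finished h : (#|finished h| <= m)%N.
Proof.
rewrite -sum1_card -[leqRHS]card_ord -sum1_card (big_ord_widen k (fun=> 1%N) mk).
rewrite big_mkcond [leqRHS]big_mkcond /=; apply: leq_sum => j _.
by case: ifP => // /finished_lt ->.
Qed.

Lemma round_robinS h h' : changes h' = (changes h).+1 -> A h' != A h.
Proof.
move=> e; apply/eqP => /(congr1 (@nat_of_ord k))/eqP.
rewrite !val_round_robin ?mk ?andbT ?(ltnW m2)// e; apply/negP; rewrite -addn1 -{2}[changes h]addn0 eqn_modDl.
by rewrite modn_small// mod0n.
Qed.

Lemma finished_rcons_eq h x : (t0 <= size h)%N -> last 0 h = x ->
  finished (rcons h x) = finished h.
Proof.
move=> th0 e; have C : changes (rcons h x) = changes h by rewrite changes_rcons e eqxx addn0.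
have AE : A (rcons h x) = A h by apply/val_inj; rewrite /= C.
by apply/funext => j; rewrite /finished AE C take_rcons_le.
Qed.

Lemma finished_rcons_neq h x j : (t0 <= size h)%N -> last 0 h != x ->
  finished (rcons h x) j = (j != A (rcons h x)) && (finished h j || (j == A h)).
Proof.
move=> th0 e; have C : changes (rcons h x) = (changes h).+1 by rewrite changes_rcons e addn1.
rewrite {1}/finished; congr andb; rewrite C take_rcons_le//.
rewrite /index_iota subSn ?changes_take_le// -addn1 iotaD has_cat /=.
rewrite subnKC ?changes_take_le// orbF /finished -/(index_iota _ _).
have -> : (changes h %% m == j)%N = (j == A h).
  by rewrite -(inj_eq (@ord_inj k)) val_round_robin ?mk ?andbT ?(ltnW m2)// eq_sym.
by case: (j == A h); rewrite ?orbT ?orbF //= .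
Qed.

(** The last m - 1 changes left every residue but the current one. The witness is the latest earlier
    index congruent to [j], in the same block of length m or in the preceding one. *)
Lemma finished_full h j : (m <= (recent_changes t0 h).+1)%N -> j != A h -> (j < m)%N ->
  finished h j.
Proof.
move=> r jA jm; rewrite /finished jA /=.
have m0 : (0 < m)%N by exact: ltnW.
have cA : (changes h %% m)%N != j.
  by apply: contra jA => /eqP e; rewrite -(inj_eq (@ord_inj k)) val_round_robin ?m0// e.
have r' := changes_take_le h t0.
have cdiv := divn_eq (changes h) m.
have cm : (changes h %% m < m)%N by rewrite ltn_mod.
have recent d : (0 < d < m)%N ->
    (changes h - d)%N \in index_iota (changes (take t0 h)) (changes h).
  move: r r'; rewrite mem_index_iota /recent_changes; move: (changes _) (changes _) => C C'.
  lia.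
have [lt|ge] := ltnP j (changes h %% m).
  apply/hasP; exists (changes h - (changes h %% m - j))%N; first by apply: recent; lia.
  rewrite {1}cdiv (_ : (_ - _)%N = changes h %/ m * m + j)%N; first by rewrite modnMDl modn_small.
  by move: lt; move: (changes h %% m)%N (changes h %/ m * m)%N => c e; lia.
have gt : (changes h %% m < j)%N by rewrite ltn_neqAle cA.
apply/hasP; exists (changes h - (m - (j - changes h %% m)))%N; first by apply: recent; lia.
(* A zero quotient is impossible: the number of changes would be m - 1, and no residue lies above
   it. *)
have [c0|c0] := posnP (changes h %/ m)%N.
  move: cdiv gt r r'; rewrite c0 mul0n add0n /recent_changes => <-.
  by move: (changes _) (changes _) => C C'; lia.
rewrite {1}cdiv (_ : (_ - _)%N = ((changes h %/ m).-1 * m + j)%N).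
  by rewrite modnMDl modn_small.
have e : (changes h %/ m * m = (changes h %/ m).-1 * m + m)%N.
  by rewrite -{1}(prednK c0) mulSn addnC.
by move: gt cm; rewrite e; move: (changes h %% m)%N (_.-1 * m)%N => c d; lia.
Qed.

Hypotheses (t0N : (t0 <= N)%N) (q1 : 1 <= q) (B0 : 0 <= B).
Hypotheses (th0 : 0 <= th) (thq : th <= lam / q) (lam1 : lam < 1).
Hypothesis p_lb : forall t p s, (t0 <= t <= N)%N -> core eps A t p s ->
  q^-1 <= srv_p s /\ gam <= (srv_p s)^-1 - 1.
Hypothesis p_ub : forall s, valid eps A t0 s -> srv_p s <= B / q.

Let q0 : 0 < q. Proof. exact: lt_le_trans q1. Qed.

Let lam0 : 0 <= lam.
Proof. by rewrite -(pmulr_lge0 _ (_ : 0 < q^-1)) ?invr_gt0//; exact: le_trans thq. Qed.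

Let eta0 : 0 <= lam / (1 - lam).
Proof. by apply: divr_ge0 => //; rewrite subr_ge0 ltW. Qed.

Lemma site_term_ge0 p x : 0 <= site_term p x.
Proof. exact: expR_ge0. Qed.

Lemma est_term_ge0 p y h : 0 <= est_term p y h.
Proof. by rewrite /est_term; case: ifP => // _; exact: expR_ge0. Qed.

Lemma error_potential_ge0 s : 0 <= error_potential s.
Proof.
apply: mulr_ge0; last by rewrite le_max site_term_ge0.
by apply: mulr_ge0 => //; exact: ltW.
Qed.

Lemma le_site_term p x y : x <= y -> site_term p y <= site_term p x.
Proof. by move=> xy; rewrite ler_expR !mulNr lerN2 ler_wpM2l// lerD2r. Qed.

Lemma bonus_le p p' : 0 < p' -> p' <= p -> bonus p <= bonus p'.
Proof.
move=> p0 pp; rewrite /bonus; apply: ler_wpM2l; first by apply: mulr_ge0.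
by rewrite lef_pV2 ?posrE//; exact: lt_le_trans pp.
Qed.

Lemma est_term_le p p' y h : 0 < p' -> p' <= p -> est_term p' y h <= est_term p y h.
Proof.
move=> p0 pp; rewrite /est_term; case: ifP => // _.
by rewrite ler_expR !mulNr lerN2 ler_wpM2l// lerD2l bonus_le.
Qed.

Lemma hat_of_le (p : R) b n : (b <= n)%N -> 0 < p <= 1 -> hat_of p b - n%:R <= p^-1 - 1.
Proof.
move=> bn /andP[p0 p1]; have ip : 1 <= p^-1 by rewrite invf_ge1.
have := ler0n R n; move: bn; rewrite -(ler_nat R) /hat_of.
by case: eqP => _; lra.
Qed.

Section Step.
Variables (t : nat) (s : state R k).
Hypotheses (tN : (t0 <= t < N)%N) (v : valid eps A t s).

Let c : core eps A t (srv_p s) s := valid_core v.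
Let p : R := srv_p s.
Let p01 : 0 < p <= 1 := core_srv_p c.
Let u rep := reported eps A rep s.
Let h' rep := rcons (hist s) (est (u rep)).

Let hist_u rep : hist (publish (u rep)) = h' rep.
Proof. by []. Qed.

Let th_size : (t0 <= size (hist s))%N.
Proof. by rewrite (valid_size v); case/andP: tN. Qed.

Let gam_p : gam <= p^-1 - 1.
Proof. by case/andP: tN => t0t tN'; have [] := p_lb (introT andP (conj t0t (ltnW tN'))) c. Qed.

Let hat_cur : hatn (u true) (cur A s) - (cnt (u true) (cur A s))%:R = p^-1 - 1.
Proof. by rewrite /= !ffunE eqxx /p; ring. Qed.

Let hat_other rep j : j != cur A s -> hatn (u rep) j = hatn s j /\ cnt (u rep) j = cnt s j.
Proof. by case: rep => /negbTE jc; rewrite /= !ffunE jc. Qed.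

(** This covers silence and missed reports alike: both touch only the current site, which [finished]
    excludes. *)
Lemma gain_silent rep : est (u rep) = est s ->
  gain (publish (u rep)) = gain s.
Proof.
move=> e; rewrite /gain hist_u /h' e finished_rcons_eq ?(valid_est v)//.
apply: eq_bigr => j /andP[jA _].
by have [-> ->] := hat_other rep jA.
Qed.

(** The site being left enters with the largest possible term 1/p - 1 - gam, which is nonnegative;
    the site being entered takes out at most as much. *)
Lemma gain_detected : est (u true) != est s ->
  gain s <= gain (publish (u true)).
Proof.
move=> e; have ne : last 0 (hist s) != est (u true) by rewrite (valid_est v) eq_sym.
have cc' : A (h' true) != cur A s.
  by apply: round_robinS; rewrite changes_rcons ne addn1.
pose f j := hatn s j - (cnt s j)%:R - gam.
have -> : gain (publish (u true)) = p^-1 - 1 - gam +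
    \sum_(j | finished (hist s) j && (j != A (h' true))) f j.
  rewrite /gain hist_u.
  rewrite (bigD1 (cur A s))/=; last first.
    by rewrite finished_rcons_neq// eq_sym cc' eqxx orbT.
  congr (_ + _); first by rewrite -hat_cur.
  apply: eq_big => j; last first.
    by move=> /andP[_ jA]; have [-> ->] := hat_other true jA.
  rewrite finished_rcons_neq// andbC; have [->|jA] := eqVneq j (cur A s).
    by rewrite /finished /cur eqxx.
  by rewrite /= orbF andbC.
rewrite /gain (bigID (fun j => j == A (h' true)))/=; apply: lerD => //.
have c'0 : 0 <= p^-1 - 1 - gam by rewrite subr_ge0.
have [fc|fc] := boolP (finished (hist s) (A (h' true))).
  rewrite (big_pred1 (A (h' true))) => [|j]; last first.
    by case: eqVneq => [->|/negbTE jA] /=; rewrite ?fc ?eqxx ?jA ?andbF.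
  by rewrite lerD2r (core_hat c) hat_of_le// (core_bar c).
rewrite big1// => j /andP[fj /eqP je]; by rewrite -je fj in fc.
Qed.

(** Right after a report the published error is the sum of the errors of the m sites. The current
    one contributes 1/p - 1 >= gam; by [finished_full] the others are those of [gain]. *)
Lemma gain_le_error : est (u true) != est s ->
  (m <= recent_changes t0 (h' true))%N ->
  gain s <= est (u true) - (last_change (h' true))%:R - m%:R * gam.
Proof.
move=> e r; have ne : last 0 (hist s) != est (u true) by rewrite (valid_est v) eq_sym.
have c1 := core_reported true c.
have -> : last_change (h' true) = (\sum_j cnt (u true) j)%N.
  by rewrite last_change_rcons ne (valid_size v) (core_cnt c1).
have -> : est (u true) = \sum_j hatn (u true) j by [].
rewrite natr_sum -sumrB sum_lt_m => [|j mj]; last first.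
  have jA h : A h != j.
    apply/eqP => /(congr1 (@nat_of_ord k)); rewrite val_round_robin ?mk ?(ltnW m2)// => jE.
    by move: mj; rewrite -jE leqNgt ltn_mod ltnW.
  by rewrite (unvisited_hat c1 jA) (core_unvisited c1 jA) subr0.
have cm : (cur A s < m)%N by rewrite /cur val_round_robin ?mk ?(ltnW m2)// ltn_mod ltnW.
rewrite -sum_const_lt_m -sumrB (bigD1 (cur A s)) //.
rewrite hat_cur /gain -[leLHS]add0r; apply: lerD; first by rewrite subr_ge0.
have r' : (m <= (recent_changes t0 (hist s)).+1)%N.
  by move: r; rewrite recent_changes_rcons// ne addn1.
rewrite le_eqVlt; apply/orP; left; apply/eqP; apply: eq_big => j.
  apply/idP/andP => [fj|[jm jA]]; last exact: finished_full.
  by split; [exact: finished_lt fj | case/andP: fj].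
by move=> /andP[jA _]; have [-> ->] := hat_other true jA.
Qed.

Let M : R := Num.max (site_term p (gain s)) (est_term p (est s) (hist s)).

(** If the estimate does not change, neither term moves; after a visible report both are bounded by
    the old [site_term]. *)
Lemma terms_reported rep :
  site_term p (gain (publish (u rep))) <= M /\ est_term p (est (u rep)) (h' rep) <= M.
Proof.
have [e|e] := eqVneq (est (u rep)) (est s).
  rewrite gain_silent// /M; split; first by rewrite le_max lexx.
  rewrite /est_term recent_changes_rcons// last_change_rcons e (valid_est v) eqxx /= addn0.
  by rewrite le_max lexx orbT.
case: rep e => [e|]; last by rewrite /= eqxx.
split; first by apply: (@le_trans _ _ (site_term p (gain s))); [exact: le_site_term (gain_detected e) | rewrite le_max lexx].
apply: (@le_trans _ _ (site_term p (gain s))); last by rewrite le_max lexx.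
rewrite /est_term; case: ifP => r; last exact: site_term_ge0.
rewrite ler_expR !mulNr lerN2 ler_wpM2l// lerD2r; exact: gain_le_error.
Qed.

(** In a real resampling the maximum is bounded by the sum, each summand has expectation at most
    [M], and 2 p' <= p restores the bound. *)
Lemma error_potential_branch rep :
  (Ex (resampled eps A rep s) (fun s' => (error_potential (publish s'))%:E) <=
   (error_potential s)%:E)%E.
Proof.
have [sM eM] := terms_reported rep; have [p0 p1] := andP p01.
have M0 : 0 <= M by rewrite le_max site_term_ge0.
have -> : error_potential s = p * q * M by rewrite /error_potential gtr0_norm.
have [[e ->]|[half rE]] := resampled_cases k0 eps0 rep v.
- rewrite lee_fin /error_potential [srv_p (publish _)]e gtr0_norm// -/p.
  apply: ler_wpM2l; first by rewrite mulr_ge0// ltW.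
  by rewrite ge_max sM eM.
- by move=> s'; rewrite lee_fin error_potential_ge0.
have [np0 [npp np1]] := next_p_le k0 eps0 c.
set p' := next_p eps A s in rE half np0 npp np1 *.
have p'q : 0 <= p' * q by rewrite mulr_ge0// ltW.
pose Q := finished (h' rep).
(* Collects the part of [site_term] that the resampling does not randomize, leaving the factor
   [exp_hat]. *)
pose K := expR (th * \sum_(j | Q j) ((cnt (u rep) j)%:R + gam) - th * bonus p').
have KE s' : outcome eps A t rep s s' ->
    ((error_potential (publish s'))%:E <=
    (p' * q)%:E * (K%:E * exp_hat th Q s' + (est_term p (est (u rep)) (h' rep))%:E))%E.
  move=> [c' cE hE eE pE]; rewrite /error_potential [srv_p _]pE -/p' gtr0_norm//.
  rewrite /exp_hat -!EFinM lee_fin; apply: ler_wpM2l => //.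
  have hist' : hist (publish s') = h' rep by rewrite /h' -eE -hE.
  have est' : est (publish s') = est (u rep) by [].
  rewrite hist' est' ge_max; apply/andP; split.
    rewrite -[leLHS]addr0; apply: lerD; last exact: est_term_ge0.
    rewrite /site_term /gain hist' -/Q -expRD ler_expR.
    rewrite [X in _ <= X](_ : _ = - th * (\sum_(j | Q j) hatn s' j -
      \sum_(j | Q j) ((cnt (u rep) j)%:R + gam) + bonus p')); last by ring.
    rewrite -sumrB le_eqVlt; apply/orP; left; apply/eqP; congr (_ * (_ + _)).
    by apply: eq_bigr => j _; rewrite opprD addrA -cE.
  rewrite -[leLHS]add0r; apply: lerD; first by rewrite mulr_ge0 ?expR_ge0.
  exact: est_term_le.
have cr := core_reported rep c.
have rg := resampled_ge0 k0 eps0 rep c.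
apply: (le_trans (le_Ex rg (@supp_resampled _ _ _ _ k0 eps0 _ rep _ v) KE)).
rewrite ExZ//; last first.
  by move=> s'; rewrite adde_ge0 ?mule_ge0 ?lee_fin ?expR_ge0 ?est_term_ge0.
rewrite ExD//; last 2 first.
- by move=> s'; rewrite mule_ge0 ?lee_fin ?expR_ge0.
- by move=> s'; rewrite lee_fin est_term_ge0.
rewrite ExZ//; [|by rewrite lee_fin expR_ge0|by move=> s'; rewrite lee_fin expR_ge0].
rewrite Ex_cst//; [|exact: mass1_resampled c|by rewrite lee_fin est_term_ge0].
(* The lower bound is applied to the intermediate state [u rep], whose [srv_p] is already p'; for
   this [p_lb] speaks of [core] with a free p. *)
have thp' : th <= lam * p'.
  apply: le_trans thq _; rewrite ler_wpM2l//.
  have t1N : (t0 <= t.+1 <= N)%N by case/andP: tN => h1 h2; rewrite leqW.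
  by have [] := p_lb t1N cr.
have hp' : forall j, hatn (u rep) j = hat_of p (barn (u rep) j) by exact: core_hat cr.
have hb := Ex_resample_hat Q np0 npp np1 th0 thp' lam1 hp'.
apply: (@le_trans _ _ ((p' * q)%:E * (M%:E + M%:E))%E).
  apply: lee_wpmul2l; first by rewrite lee_fin.
  apply: leeD; last first.
    by rewrite lee_fin; apply: le_trans eM; exact: est_term_le.
  rewrite rE; apply: (@le_trans _ _ (K%:E * (exp_hat th Q (u rep) *
     (expR (th * (lam / (1 - lam)) * (p'^-1 - p^-1) * #|Q|%:R))%:E))%E).
    by apply: lee_wpmul2l; [rewrite lee_fin expR_ge0 | exact: hb].
  rewrite /exp_hat -!EFinM lee_fin; apply: le_trans sM.
  rewrite -!expRD /site_term ler_expR /gain hist_u -/Q.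
  have -> : \sum_(j | Q j) (hatn (publish (u rep)) j - (cnt (publish (u rep)) j)%:R - gam) =
     \sum_(j | Q j) hatn (u rep) j - \sum_(j | Q j) ((cnt (u rep) j)%:R + gam).
    by rewrite -sumrB; apply: eq_bigr => j _; rewrite opprD addrA.
  have Qm : th * (lam / (1 - lam)) * (p'^-1 - p^-1) * #|Q|%:R <=
            th * (lam / (1 - lam)) * (p'^-1 - p^-1) * m%:R.
    apply: ler_wpM2l; last by rewrite ler_nat card_finished.
    by apply: mulr_ge0; [exact: mulr_ge0 | rewrite subr_ge0 lef_pV2 ?posrE].
  (* The growth of the bonus is exactly the cost of resampling m sites. *)
  have -> : bonus p = bonus p' - lam / (1 - lam) * (p'^-1 - p^-1) * m%:R.
    by rewrite /bonus; ring.
  set H := \sum_(j | Q j) hatn (u rep) j; set C := \sum_(j | Q j) (_ + _).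
  move: Qm; set D := lam / (1 - lam); set E := p'^-1 - p^-1; lra.
rewrite -EFinD -EFinM lee_fin.
apply: (@le_trans _ _ ((p' * 2) * (q * M))); first by rewrite le_eqVlt; apply/orP; left; apply/eqP; ring.
rewrite -[leRHS]mulrA; apply: ler_wpM2r; first by rewrite mulr_ge0// ltW.
by rewrite -ler_pdivlMr.
Qed.

Lemma error_potential_step :
  (Ex (step eps A s) (fun s' => (error_potential s')%:E) <= (error_potential s)%:E)%E.
Proof.
apply: (Ex_step_le k0 eps0 v _ (error_potential_branch true) (error_potential_branch false)).
  by move=> s'; rewrite lee_fin error_potential_ge0.
by rewrite -mulrDl addrC subrK mul1r.
Qed.

End Step.

(** At [t0] no site is finished and no change is recent, so only the bonus remains in [site_term]
    and [est_term] is 0. *)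
Lemma error_potential_start s : valid eps A t0 s -> error_potential s <= B.
Proof.
move=> v; have c := valid_core v; have [p0 _] := andP (core_srv_p c).
have tk : take t0 (hist s) = hist s by rewrite take_oversize// (valid_size v).
rewrite /error_potential gtr0_norm// -[leRHS]mulr1; apply: ler_pM.
- by rewrite mulr_ge0// ltW.
- by rewrite le_max site_term_ge0.
- by rewrite -ler_pdivlMr// p_ub.
rewrite ge_max; apply/andP; split.
  rewrite /site_term /gain big1 => [|j]; last first.
    by rewrite /finished tk /index_iota subnn /= andbF.
  rewrite add0r -expR0 ler_expR mulNr oppr_le0 mulr_ge0// /bonus.
  by apply: divr_ge0; [exact: mulr_ge0 | exact: ltW].
by rewrite /est_term /recent_changes tk subnn leqNgt ltnW.
Qed.

Lemma error_potential_law :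
  (Ex (law eps A N) (fun s => (error_potential s)%:E) <= B%:E)%E.
Proof.
apply: (law_supermartingale k0 eps0 epsk (F := fun=> fun s => (error_potential s)%:E) t0N).
- by rewrite lee_fin.
- by move=> t s; rewrite lee_fin error_potential_ge0.
- by move=> t s tN v; exact: error_potential_step tN v.
- by move=> s v; rewrite lee_fin; exact: error_potential_start.
Qed.

(** A small published error after a full round forces a large potential, which Markov's inequality
    makes unlikely. Here p q >= 1 removes the prefactor and bounds the bonus. *)
Lemma error_potential_end s y : valid eps A N s ->
  (m <= recent_changes t0 (hist s))%N -> est s - (last_change (hist s))%:R <= y ->
  expR (th * (m%:R * gam - y - lam / (1 - lam) * m%:R * q)) <= error_potential s.
Proof.
move=> v r ey; have c := valid_core v; have [p0 _] := andP (core_srv_p c).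
have pq : q^-1 <= srv_p s by have [] := p_lb (_ : (t0 <= N <= N)%N) c; rewrite ?t0N ?leqnn.
have pq1 : 1 <= srv_p s * q by rewrite -ler_pdivrMr// mul1r.
rewrite /error_potential gtr0_norm//.
apply: (@le_trans _ _ (est_term (srv_p s) (est s) (hist s))); last first.
  apply: (@le_trans _ _ (Num.max (site_term (srv_p s) (gain s)) (est_term (srv_p s) (est s) (hist s)))).
    by rewrite le_max lexx orbT.
  by rewrite ler_peMl// le_max site_term_ge0.
rewrite /est_term r ler_expR mulNr -mulrN; apply: ler_wpM2l => //.
have : bonus (srv_p s) <= lam / (1 - lam) * m%:R * q.
  rewrite /bonus; apply: ler_wpM2l; first by apply: mulr_ge0.
  by rewrite -[leRHS]invrK lef_pV2 ?posrE// invr_gt0.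
lra.
Qed.

End ErrorPotential.

(** * Choice of windows and constants, for few and for many sites *)

Lemma succ_truncn (R : realType) (x : R) : 0 <= x ->
  (Num.truncn x).+1%:R - 1 <= x < (Num.truncn x).+1%:R.
Proof.
move=> /truncn_itv /andP[h1 h2]; rewrite h2 andbT.
by rewrite -[(_).+1]addn1 natrD addrK.
Qed.

Section Overestimate.
Variables (R : realType) (k : nat) (eps : R) (N : nat).
Hypotheses (k0 : (0 < k)%N) (eps0 : 0 < eps) (epsk : eps <= (Num.sqrt k%:R)^-1).
Hypothesis (N_large : 32 * Num.sqrt k%:R / eps < N%:R).
Implicit Types (s : state R k).

Variable q : R.
Hypothesis qE : q = 2 * eps * N%:R / Num.sqrt k%:R.

Let sk0 : 0 < Num.sqrt k%:R :> R. Proof. by rewrite sqrtr_gt0 ltr0n. Qed.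

Let sk2 : Num.sqrt k%:R * Num.sqrt k%:R = k%:R :> R.
Proof. by rewrite -expr2 sqr_sqrtr ?ler0n. Qed.

(** The threshold on [N] is chosen for this bound; it makes additive constants small against
    q/16. *)
Let q64 : 64 < q.
Proof.
rewrite qE ltr_pdivlMr//; move: N_large; rewrite ltr_pdivrMr//.
by rewrite (mulrC _ eps); lra.
Qed.

Let q0 : 0 < q. Proof. by apply: lt_trans q64. Qed.

Let q1 : 1 <= q. Proof. by move: q64; lra. Qed.

Let invq : 0 <= q^-1 <= 1.
Proof. by rewrite invr_ge0 ltW//= invf_le1. Qed.

(** By eps <= 1/sqrt k, windows of order k q events fit into the stream. *)
Let kq : k%:R * q <= 2 * N%:R.
Proof.
rewrite qE -{1}sk2 (_ : _ * _ = 2 * N%:R * (eps * Num.sqrt k%:R)); last first.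
  by field; rewrite gt_eqF.
rewrite -[leRHS]mulr1; apply: ler_wpM2l; first by rewrite mulr_ge0// ler0n.
by rewrite -ler_pdivlMr// mul1r.
Qed.

Let error_scale : Num.sqrt k%:R * eps * N%:R = k%:R * q / 2.
Proof. by rewrite qE -[X in _ = X * _ / _]sk2; field; rewrite gt_eqF. Qed.

Let q2N : q <= 2 * N%:R.
Proof.
apply: le_trans kq; rewrite ler_peMl ?ler1n//; exact: ltW.
Qed.

Let N32 : 32 < N%:R :> R. Proof. by move: q64 q2N; lra. Qed.

(** In the second half of the stream N/8 <= tau <= N. The upper end gives 1/q, the rounding loss of
    2 being included in q; the lower end gives 8 sqrt k / (eps N) = 16/q. *)
Let late_p A t p s : N%:R <= 2 * t%:R :> R -> (t <= N)%N -> core eps A t p s ->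
  q^-1 <= srv_p s <= 16 / q.
Proof.
move=> Nt tN c; have t1 : (1 <= t)%N.
  by rewrite lt0n; apply/eqP => t0; move: Nt N32; rewrite t0; lra.
have tau1 := core_tau0 c; have tauR : 0 < (tau s)%:R :> R by rewrite ltr0n.
have tauN : (tau s)%:R <= N%:R :> R.
  rewrite ler_nat; apply: leq_trans tN; have := core_tau c.
  by rewrite (maxn_idPr t1).
have tau8 : N%:R <= 8 * (tau s)%:R :> R.
  have := core_tau_lb c; rewrite -(ler_nat R) natrM; lra.
have N0 : 0 < N%:R :> R by lra.
have invqE : q^-1 = Num.sqrt k%:R / (eps * N%:R) / 2.
  by rewrite qE; field; rewrite !gt_eqF.
rewrite (core_p c); apply/andP; split.
  apply: new_p_lb => //; first by case/andP: invq.
  rewrite invqE ler_pM2r// ler_pM2l// lef_pV2 ?posrE ?mulr_gt0//.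
  by rewrite ler_pM2l.
apply: le_trans (new_p_ub k0 eps0 tau1) _.
rewrite invqE [leRHS](_ : _ = Num.sqrt k%:R / eps * (8 / N%:R)); last first.
  by field; rewrite !gt_eqF.
rewrite invfM mulrA; apply: ler_wpM2l; first by rewrite ltW// divr_gt0.
by rewrite ler_pdivlMr// ler_pdivrMl// mulrC.
Qed.

Lemma prob_mono (T : choiceType) (mu : dist R T) (E F : set T) : nonneg mu ->
  E `<=` F -> (prob mu E <= prob mu F)%E.
Proof.
move=> mu0 EF; rewrite !prob_Ex; apply: (le_Ex (P := fun=> True) mu0) => // x _.
rewrite lee_fin !indicE ler_nat; case: (boolP (x \in E)) => // /set_mem/EF xF.
by rewrite mem_set.
Qed.

Lemma expr1B_le (x : R) n : 0 <= x <= 1 -> (1 - x) ^+ n <= expR (- (n%:R * x)).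
Proof.
move=> /andP[x0 x1]; rewrite -mulrN expRM_natl.
by rewrite lerXn2r ?nnegrE ?expR_ge0 ?subr_ge0//; exact: expR_ge1Dx.
Qed.

(** With L about q/64 the overestimate q/16 exceeds the staleness L by a multiple of q, and (1 -
    1/q)^L <= e^(-1/64), which suffices for bounded k. *)
Lemma few_sites_overestimate (c1 c2 : R) (i0 : 'I_k) :
  c1 * k%:R <= 64^-1 -> c2 * k%:R <= 64^-1 ->
  ((1 - expR (- (c2 * k%:R)))%:E <= prob (law eps (fun=> i0) N)
     [set s : state R k | (c1 * Num.sqrt k%:R * eps * N%:R < est s - N%:R)%R])%E.
Proof.
move=> hc1 hc2; have [L /andP[Lub Llb]] : exists L : nat, L%:R - 1 <= q / 64 < L%:R.
  by exists (Num.truncn (q / 64)).+1; apply: succ_truncn; rewrite divr_ge0// ltW.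
have LN : (L <= N)%N by rewrite -(ler_nat R); move: Lub q2N N32; lra.
have L2 : L%:R <= N%:R / 2 :> R by move: Lub q2N N32; lra.
have NL : (N - L)%:R = N%:R - L%:R :> R by rewrite natrB.
have n0 : nonneg (law eps (fun=> i0) N) by have [] := law_facts (fun=> i0) k0 eps0 epsk N.
apply: (@le_trans _ _ (prob (law eps (fun=> i0) N)
    [set s : state R k | ((N - L)%:R + q / 16 <= est s)%R])); last first.
  apply: prob_mono => // s /=; rewrite NL => h.
  have -> : c1 * Num.sqrt k%:R * eps * N%:R = c1 * (k%:R * q / 2).
    by rewrite -error_scale; ring.
  have : c1 * (k%:R * q / 2) <= q / 64 / 2.
    have : c1 * k%:R * q <= 64^-1 * q by rewrite ler_pM2r.
    lra.
  by move: Lub q64; lra.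
apply: le_trans (single_site_overestimate k0 eps0 epsk LN (_ : 1 <= q) _).
- rewrite lee_fin lerD2l lerN2; apply: le_trans (expr1B_le _ invq) _.
  rewrite ler_expR lerN2; apply: le_trans hc2 _.
  by rewrite ler_pdivlMr// mulrC; lra.
- exact: q1.
- move=> t s /andP[h1 h2] v; move: h1; rewrite -(ler_nat R) NL => h1.
  have ht : N%:R <= 2 * t%:R :> R by lra.
  have /andP[l u] := late_p ht (ltnW h2) (valid_core v); split => //.
  have [p0 _] := andP (core_srv_p (valid_core v)).
  by rewrite -[q / 16]invf_div lef_pV2 ?posrE ?divr_gt0.
Qed.

(** Two windows end at [N]: a long one, [W], for a full round, and a short one, [L], containing at
    least one change, so that the published value is at most [L] events old. Since 32 m <= k gives
    16 m q <= N, both lie in the second half. *)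
Lemma many_sites_overestimate (c1 c2 : R) :
  c1 <= (32 * 100)^-1 -> c2 <= (2 * (64 * 100 * 100))^-1 -> 160 * (64 * 100 * 100) <= k%:R :> R ->
  ((1 - expR (- (c2 * k%:R)))%:E <= prob (law eps (round_robin (k %/ 32) k0) N)
     [set s : state R k | (c1 * Num.sqrt k%:R * eps * N%:R < est s - N%:R)%R])%E.
Proof.
move=> hc1 hc2 kK; set m := (k %/ 32)%N.
have m_ub : 32 * m%:R <= k%:R :> R.
  by rewrite -natrM ler_nat /m mulnC leq_trunc_div.
have m_lb : k%:R <= 32 * m%:R + 32 :> R.
  by rewrite -natrM -natrD ler_nat mulnC -mulSnr ltnW// ltn_ceil.
have m64 : k%:R <= 64 * m%:R :> R by lra.
have m0 : 0 < m%:R :> R by lra.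
have m2 : (1 < m)%N by rewrite -(ltr_nat R); lra.
pose w : R := m%:R / (100 * 100).
have w_lb : 160 <= w by rewrite /w; lra.
have c2k : c2 * k%:R <= w / 2.
  apply: (@le_trans _ _ ((2 * (64 * 100 * 100))^-1 * k%:R)); first by rewrite ler_wpM2r.
  by rewrite /w; lra.
have m128 : 128 <= m%:R :> R by lra.
clear kK hc2.
have mk : (m <= k)%N by rewrite /m leq_div.
have mq : 0 < m%:R * q by rewrite mulr_gt0.
have mqN : 16 * (m%:R * q) <= N%:R.
  have : 32 * m%:R * q <= k%:R * q by rewrite ler_pM2r.
  by move: kq; lra.
have mq128 : 128 <= m%:R * q.
  have : 128 * 64 <= m%:R * q; last lra.
  by apply: ler_pM => //; exact: ltW q64.
(* Long enough that (1 - 1/(2q))^W <= e^(-2m) beats the Markov factor 2^m. *)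
have [W /andP[Wub Wlb]] : exists W : nat, W%:R - 1 <= 4 * (m%:R * q) < W%:R.
  by exists (Num.truncn (4 * (m%:R * q))).+1; apply: succ_truncn; rewrite mulr_ge0 ?ltW.
(* Staleness costs at most m q / 64, against an error of about m q / 16, and no change occurs with
   probability at most 32 e^(-m/256). *)
have [L /andP[Lub Llb]] : exists L : nat, L%:R - 1 <= m%:R * q / 128 < L%:R.
  by exists (Num.truncn (m%:R * q / 128)).+1; apply: succ_truncn; rewrite divr_ge0 ?ltW.
have W2 : W%:R <= N%:R / 2 :> R by move: N32; lra.
have L2 : L%:R <= N%:R / 2 :> R by move: N32; lra.
have WN : (W <= N)%N by rewrite -(ler_nat R); move: N32; lra.
have LN : (L <= N)%N by rewrite -(ler_nat R); move: N32; lra.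
have late (X : nat) : X%:R <= N%:R / 2 :> R -> (X <= N)%N ->
    forall t : nat, (N - X <= t)%N -> N%:R <= 2 * t%:R :> R.
  by move=> X2 XN t; rewrite -(ler_nat R) natrB//; lra.
set A := round_robin m k0.
pose lam : R := 100^-1; pose th := lam / q; pose gam := q / 16 - 1.
have gam0 : 0 <= gam by rewrite /gam; move: q64; lra.
have range (X : nat) : X%:R <= N%:R / 2 :> R -> (X <= N)%N -> forall t p s,
    (N - X <= t <= N)%N -> core eps A t p s ->
    [/\ q^-1 <= srv_p s, srv_p s <= 16 / q & gam <= (srv_p s)^-1 - 1].
  move=> X2 XN t p s /andP[h1 h2] c.
  have /andP[l u] := late_p (late X X2 XN t h1) h2 c; split => //.
  have [p0 _] := andP (core_srv_p c).
  by rewrite /gam lerD2r -[q / 16]invf_div lef_pV2 ?posrE ?divr_gt0.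
pose t0 := (N - W)%N; pose t1 := (N - L)%N.
have thq : th <= lam / q by [].
have th0 : 0 <= th by rewrite /th divr_ge0 ?invr_ge0// ltW.
have lam1 : lam < 1 by rewrite /lam invf_lt1//; lra.
have t0N : (t0 <= N)%N by exact: leq_subr.
have t1N : (t1 <= N)%N by exact: leq_subr.
have B0 : 0 <= 16 :> R by [].
have pW t s : (t0 <= t <= N)%N -> valid eps A t s -> q^-1 <= srv_p s.
  by move=> ht v; have [] := range W W2 WN t _ s ht (valid_core v).
have pL t s : (t1 <= t <= N)%N -> valid eps A t s -> q^-1 <= srv_p s.
  by move=> ht v; have [] := range L L2 LN t _ s ht (valid_core v).
have pE t p s : (t0 <= t <= N)%N -> core eps A t p s ->
    q^-1 <= srv_p s /\ gam <= (srv_p s)^-1 - 1.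
  by move=> ht c; have [] := range W W2 WN t _ s ht c.
have uW s : valid eps A t0 s -> srv_p s <= 16 / q.
  by move=> v; have [] := range W W2 WN t0 _ s (introT andP (conj (leqnn _) t0N)) (valid_core v).
have uL s : valid eps A t1 s -> srv_p s <= 16 / q.
  by move=> v; have [] := range L L2 LN t1 _ s (introT andP (conj (leqnn _) t1N)) (valid_core v).
pose CW := change_potential m k0 N t0 q N; pose CL := change_potential m k0 N t1 q N.
pose EP := error_potential m k0 t0 q th lam gam.
have CW0 s : 0 <= CW s by exact: change_potential_ge0.
have CL0 s : 0 <= CL s by exact: change_potential_ge0.
have EP0 s : 0 <= EP s by exact: error_potential_ge0.
have hCW := change_potential_law eps0 epsk t0N q1 B0 pW uW.
have hCL := change_potential_law eps0 epsk t1N q1 B0 pL uL.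
have hEP := error_potential_law eps0 epsk m2 mk t0N q1 B0 th0 thq lam1 pE uW.
have eCW := change_potential_end t0N q1 pW.
have eCL := change_potential_end t1N q1 pL.
have eEP := error_potential_end t0N q1 th0 thq lam1 pE.
rewrite -/CW in hCW eCW; rewrite -/CL in hCL eCL; rewrite -/EP in hEP eEP.
have NL : t1%:R = N%:R - L%:R :> R by rewrite /t1 natrB.
have NW : (N - t0)%N = W by rewrite /t0 subKn.
have NL' : (N - t1)%N = L by rewrite /t1 subKn.
pose y := c1 * (k%:R * q / 2) + L%:R.
pose z := th * (m%:R * gam - y - lam / (1 - lam) * m%:R * q).
(* The budget in units of m q: 1/16 from [gam], minus 1/64 for its -1, 1/100 for the target error,
   1/64 for staleness and 1/99 for the bonus, leaves more than 1/100. *)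
have zm : m%:R / (100 * 100) <= z.
  have y_ub : y <= m%:R * q / 100 + m%:R * q / 64.
    apply: lerD; last by move: Lub mq128; lra.
    apply: (@le_trans _ _ ((32 * 100)^-1 * (64 * m%:R * q / 2))); last by lra.
    apply: (@le_trans _ _ ((32 * 100)^-1 * (k%:R * q / 2))).
      by apply: ler_wpM2r => //; rewrite divr_ge0// mulr_ge0// ltW.
    by rewrite ler_wpM2l// ler_pM2r// ler_pM2r.
  rewrite /z; have -> : lam / (1 - lam) = 99^-1 by rewrite /lam; field.
  have -> : m%:R / (100 * 100) = th * (m%:R * q / 100).
    by rewrite /th /lam; field; rewrite gt_eqF.
  apply: ler_wpM2l => //; rewrite /gam.
  have : 64 * m%:R <= m%:R * q by rewrite mulrC ler_pM2l// ltW.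
  move: y_ub mq; lra.
(* Each summand reaches 1 in one failure case: fewer than m changes in the long window, no change in
   the short one, or a small error despite both. *)
pose f s : \bar R := ((2 ^+ m * CW s + CL s) + expR (- z) * EP s)%:E.
pose b := 2 ^+ m * (2 * 16 * (1 - (2 * q)^-1) ^+ W) + 2 * 16 * (1 - (2 * q)^-1) ^+ L + expR (- z) * 16.
have [n0 sn mn] := law_facts A k0 eps0 epsk N.
apply: (@le_trans _ _ (1 - b)%:E); last first.
  apply: (@prob_ge _ _ _ _ _ f b n0 mn sn).
  - move=> s; rewrite lee_fin; apply: addr_ge0; last exact: mulr_ge0 (expR_ge0 _) (EP0 s).
    by apply: addr_ge0 => //; apply: mulr_ge0; rewrite ?exprn_ge0.
  - move=> s v /negP; rewrite -leNgt => bad; rewrite lee_fin.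
    clear w_lb c2k hc1 zm W2 L2 Wub Lub Wlb Llb hCW hCL hEP.
    have [rW|rW] := ltnP (recent_changes t0 (hist s)) m.
      have h : 1 <= 2 ^+ m * CW s.
        apply: (@le_trans _ _ (2 ^+ m * 2^-1 ^+ recent_changes t0 (hist s))).
          rewrite exprVn ler_pdivlMr ?exprn_gt0// mul1r.
          by apply: ler_weXn2l; [rewrite ler1n | exact: ltnW].
        by apply: ler_wpM2l; [exact: exprn_ge0 | exact: eCW].
      by have := mulr_ge0 (expR_ge0 (- z)) (EP0 s); have := CL0 s; lra.
    have h1 : 0 <= 2 ^+ m * CW s by rewrite mulr_ge0// exprn_ge0.
    have [rL|rL] := posnP (recent_changes t1 (hist s)).
      have := eCL s v; rewrite rL expr0.
      by have := mulr_ge0 (expR_ge0 (- z)) (EP0 s); lra.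
    have lc : (t1 < last_change (hist s))%N.
      by apply: last_change_gt; rewrite -subn_gt0.
    have ey : est s - (last_change (hist s))%:R <= y.
      have -> : y = c1 * Num.sqrt k%:R * eps * N%:R + L%:R.
        by rewrite /y -error_scale; ring.
      have : t1%:R <= (last_change (hist s))%:R :> R by rewrite ler_nat ltnW.
      by rewrite NL; move: bad; lra.
    have := eEP s y v rW ey; rewrite -/z => hz.
    have : 1 <= expR (- z) * EP s.
      by rewrite -[leLHS](expRxMexpNx_1 z) mulrC ler_pM2l ?expR_gt0.
    by have := CL0 s; lra.
  rewrite /f.
  have mo s : (((2 ^+ m * CW s + CL s) + expR (- z) * EP s)%:E =
     ((2 ^+ m)%:E * (CW s)%:E + (CL s)%:E) + (expR (- z))%:E * (EP s)%:E)%E by [].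
  have p2 : (0 <= (2 ^+ m : R)%:E)%E by rewrite lee_fin exprn_ge0.
  have pz : (0 <= (expR (- z))%:E)%E by rewrite lee_fin expR_ge0.
  rewrite (funext mo) ExD//; last 2 first.
  - by move=> s; rewrite -EFinM -EFinD lee_fin; apply: addr_ge0 => //; apply: mulr_ge0; rewrite ?exprn_ge0.
  - by move=> s; rewrite -EFinM lee_fin mulr_ge0// expR_ge0.
  rewrite ExD//; last by move=> s; rewrite -EFinM lee_fin mulr_ge0// exprn_ge0.
  rewrite !ExZ// /b 2!EFinD; apply: leeD; first apply: leeD.
  - by rewrite [leRHS]EFinM; apply: lee_wpmul2l => //; rewrite -NW.
  - by rewrite -NL'.
  - by rewrite [leRHS]EFinM; apply: lee_wpmul2l.
rewrite lee_fin lerD2l lerN2.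
clear - w_lb c2k q1 q0 Wlb Llb m0 zm.
have h2q : 0 <= (2 * q)^-1 <= 1.
  have q2 : 1 <= 2 * q by move: q1; lra.
  have q2p : 0 < 2 * q by exact: lt_le_trans q2.
  by rewrite invr_ge0 (ltW q2p)/= invf_le1.
have bW : (1 - (2 * q)^-1) ^+ W <= expR (- (2 * m%:R)).
  apply: le_trans (expr1B_le _ h2q) _; rewrite ler_expR lerN2.
  by rewrite ler_pdivlMr ?mulr_gt0//; move: Wlb; lra.
have bL : (1 - (2 * q)^-1) ^+ L <= expR (- (m%:R / 256)).
  apply: le_trans (expr1B_le _ h2q) _; rewrite ler_expR lerN2.
  by rewrite ler_pdivlMr ?mulr_gt0//; move: Llb; lra.
have e2 : 2 ^+ m <= expR m%:R :> R.
  rewrite -[X in expR X]mulr1 expRM_natl; apply: lerXn2r; rewrite ?nnegrE ?expR_ge0//.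
  by have := expR_ge1Dx (1 : R); lra.
have tW : 2 ^+ m * (2 * 16 * (1 - (2 * q)^-1) ^+ W) <= 32 * expR (- w).
  apply: (@le_trans _ _ (expR m%:R * (2 * 16 * expR (- (2 * m%:R))))).
    apply: ler_pM => //.
      by apply: mulr_ge0 => //; apply: exprn_ge0; rewrite subr_ge0; case/andP: h2q.
    by apply: ler_wpM2l.
  have -> : expR m%:R * (2 * 16 * expR (- (2 * m%:R))) = 32 * expR (- m%:R) :> R.
    have -> : - m%:R = m%:R + - (2 * m%:R) :> R by ring.
    by rewrite expRD; ring.
  by rewrite ler_wpM2l// ler_expR lerN2 /w; lra.
have tL : 2 * 16 * (1 - (2 * q)^-1) ^+ L <= 32 * expR (- w).
  apply: (@le_trans _ _ (2 * 16 * expR (- (m%:R / 256)))); first by apply: ler_wpM2l.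
  have -> : 2 * 16 = 32 :> R by ring.
  by rewrite ler_wpM2l// ler_expR lerN2 /w; lra.
have tz : expR (- z) * 16 <= 16 * expR (- w).
  by rewrite mulrC ler_wpM2l// ler_expR lerN2.
apply: (@le_trans _ _ (80 * expR (- w))); first by rewrite /b; move: tW tL tz; lra.
(* 80 = 32 + 32 + 16 is the total prefactor; w >= 160 lets half of the exponent absorb it. *)
have h80 : 80 <= expR (w / 2).
  by apply: le_trans (expR_ge1Dx _); move: w_lb; lra.
apply: (@le_trans _ _ (expR (w / 2) * expR (- w))); first by rewrite ler_wpM2r ?expR_ge0.
by rewrite -expRD ler_expR; move: c2k; lra.
Qed.

End Overestimate.

Theorem mainTheorem1 (R : realType) :
  exists c1 c2 c3 : R, 0 < c1 /\ 0 < c2 /\ 0 < c3 /\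
  forall (k : nat) (eps : R),
    (1 <= k)%N -> 0 < eps -> eps <= (Num.sqrt k%:R)^-1 ->
    exists A : seq R -> 'I_k,
      forall n : nat, c3 * Num.sqrt k%:R / eps < n%:R ->
        ((1 - expR (- (c2 * k%:R)))%:E <=
           prob (law eps A n)
             [set s : state R k | (c1 * Num.sqrt k%:R * eps * n%:R < est s - n%:R)%R])%E.
Proof.
(* As k <= 64 m, k >= K gives m / 100^2 >= 160. The common constant 1/(64 K) keeps its product with
   k below 1/64 when k <= K. *)
pose K : R := 160 * (64 * 100 * 100).
have K0 : 0 < K by rewrite /K; lra.
have c0 : 0 < (64 * K)^-1 by rewrite invr_gt0 mulr_gt0.
have c_ub (x : R) : 0 < x -> x <= 64 * K -> (64 * K)^-1 <= x^-1.
  by move=> x0 xK; rewrite lef_pV2 ?posrE ?mulr_gt0.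
exists (64 * K)^-1, (64 * K)^-1, 32; do 3! split => //.
move=> k eps k0 eps0 epsk; have [kK|Kk] := leP k%:R K.
  have ck : (64 * K)^-1 * k%:R <= 64^-1.
    by rewrite invfM -mulrA ler_piMr// ler_pdivrMl// mulr1.
  exists (fun=> Ordinal k0) => n n_large.
  exact: (few_sites_overestimate k0 eps0 epsk n_large (erefl _)).
exists (round_robin (k %/ 32) k0) => n n_large.
apply: (many_sites_overestimate k0 eps0 epsk n_large (erefl _)).
- by apply: c_ub; rewrite /K; lra.
- by apply: c_ub; rewrite /K; lra.
- exact: ltW.
Qed.
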